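(* Let $-A$ be the infinitesimal generator of a semigroup $(T_t)_{t>0}$ as in the standing setting described in the context, and let $g$ be a Bernstein function. Suppose that $A$ satisfies a super-Poincaré inequality with rate function $\beta:(0,+\infty)\to(0,+\infty)$, i.e. for every $f\in\mathcal D(A)\cap L^1(\mu)$, $$\|f\|_2^2\le r\,(Af,f)+\beta(r)\,\|f\|_1^2\qquad\text{for all } r>0.$$ Set $r_0=\frac{1}{g(+\infty)}$ and $r_1=\frac{1}{g(0^+)}$. Then $g(A)$ satisfies an $(r_0,r_1)$-super-Poincaré inequality with rate function $\beta_g(r)=\beta\left(\frac{1}{g^{-1}(1/r)}\right)$, i.e. for every $f\in\mathcal D(g(A))\cap L^1(\mu)$, $$\|f\|_2^2\le r\,(g(A)f,f)+\beta\left(\frac{1}{g^{-1}(1/r)}\right)\|f\|_1^2\qquad\text{for all } r\in(r_0,r_1).$$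
   Context: Standing setting: $(X,\mu)$ is a $\sigma$-finite measure space; $(T_t)_{t>0}$ is a strongly continuous semigroup on $L^2(X,\mu)$ such that for each $t>0$, $T_t$ is a symmetric contraction on $L^2$ and is a contraction, for the $L^1$-norm, from $L^1\cap L^2$ to itself (hence $T_t$ extends to a contraction on each $L^p$, $1\le p\le+\infty$). Its infinitesimal generator on $L^2$ is $-A$, where $-Af=\lim_{t\to0^+}(T_tf-f)/t$ on the domain $\mathcal D(A)$ of those $f\in L^2$ for which this limit exists in $L^2$; $A$ is a non-negative self-adjoint operator. $(\cdot,\cdot)$ is the inner product of $L^2(\mu)$ and $\|\cdot\|_p$ the $L^p(\mu)$-norm. A Bernstein function is a $C^\infty$ function $g:(0,+\infty)\to(0,+\infty)$ with $(-1)^{n-1}g^{(n)}(s)\ge0$ for all integers $n\ge1$ and all $s>0$; $g(0^+)$ and $g(+\infty)$ denote its limits at $0$ and $+\infty$, and $g(0):=g(0^+)$. A Bernstein function is either constant (then $(r_0,r_1)$ is empty) or strictly increasing, and then $g^{-1}:(g(0^+),g(+\infty))\to(0,+\infty)$. Conventions: $1/(+\infty)=0$, $1/0=+\infty$. For measurable $\Psi:[0,+\infty)\to\mathbb R$, $\Psi(A)=\int_0^{+\infty}\Psi(\lambda)\,dE(\lambda)$ is defined through the spectral resolution $(E_\lambda)_{\lambda\ge0}$ of $A$, with domain $\mathcal D(\Psi(A))=\{f\in L^2:\int_0^{+\infty}|\Psi(\lambda)|^2d(E(\lambda)f,f)<\infty\}$; $(\Psi(A)f,f):=+\infty$ if $f\notin\mathcal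 D(\Psi(A))$. *)

(* Defs.v *)
From HB Require Import structures.
From mathcomp Require Import all_boot all_order all_algebra.
From mathcomp Require Import all_classical all_reals all_analysis.

Set Implicit Arguments.
Unset Strict Implicit.
Unset Printing Implicit Defensive.

Import Order.TTheory GRing.Theory Num.Theory.
Import numFieldNormedType.Exports.

Local Open Scope classical_set_scope.
Local Open Scope ring_scope.

(* Real-valued measurable functions with finite L^2-norm: two of them represent
   the same element of L^2(mu) when they are equal mu-almost everywhere.  The
   quotient type [LspaceType] carries no vector space structure, so operators
   act on representatives and identities in L^2(mu) are stated almost
   everywhere. *)
Notation L2 mu := (LfunType mu (lee1n 2)).

Section L2_space.
Context d (X : measurableType d) (R : realType).
Variable mu : {measure set X -> \bar R}.

Definition pnorm (p : \bar R) (f : X -> R) : R := fine ('N[mu]_p[EFin \o f])%E.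

Definition inner (f g : X -> R) : R := \int[mu]_x (f x * g x).

Definition linear_ae (T : L2 mu -> L2 mu) :=
  forall (a : R) (f g : L2 mu), T (a *: f + g) = a *: T f + T g %[ae mu].

Definition symmetric_op (T : L2 mu -> L2 mu) :=
  forall f g : L2 mu, inner (T f) g = inner f (T g).

(* Strongly continuous semigroup of symmetric contractions of L^2 that are
   also L^1-contractions on L^1 /\ L^2; T t is unconstrained for t <= 0. *)
Record contraction_semigroup (T : R -> L2 mu -> L2 mu) : Prop := {
  semigroup_linear : forall t : R, 0 < t -> linear_ae (T t) ;
  semigroup_add : forall (s t : R) (f : L2 mu), 0 < s -> 0 < t ->
    T (s + t) f = T s (T t f) %[ae mu] ;
  semigroup_continuous : forall f : L2 mu,
    pnorm 2%:E (T t f - f) @[t --> 0^'+] --> (0 : R) ;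
  semigroup_symmetric : forall t : R, 0 < t -> symmetric_op (T t) ;
  semigroup_contraction2 : forall (t : R) (f : L2 mu), 0 < t ->
    pnorm 2%:E (T t f) <= pnorm 2%:E f ;
  semigroup_L1 : forall (t : R) (f : L2 mu), 0 < t ->
    (f : X -> R) \in Lfun mu 1 -> (T t f : X -> R) \in Lfun mu 1 ;
  semigroup_contraction1 : forall (t : R) (f : L2 mu), 0 < t ->
    (f : X -> R) \in Lfun mu 1 -> pnorm 1 (T t f) <= pnorm 1 f }.

(* An unbounded operator B is given by its graph: [B f h] means that f is in
   the domain of B and that h represents B f. *)
Definition unbounded_op := L2 mu -> L2 mu -> Prop.

(* The operator A whose opposite is the infinitesimal generator of T:
   A f = h iff (T_t f - f) / t --> - h in L^2 as t --> 0+. *)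
Definition neg_generator (T : R -> L2 mu -> L2 mu) : unbounded_op :=
  fun f h => pnorm 2%:E (t^-1 *: (T t f - f) + h) @[t --> 0^'+] --> (0 : R).

(* Right-continuous resolutions of the identity (E_l)_{l >= 0}, extended by
   E_l = 0 for l < 0 so that dE may charge the point 0. *)
Record resolution_of_identity := {
  res_proj :> R -> L2 mu -> L2 mu ;
  res_linear : forall l, linear_ae (res_proj l) ;
  res_symmetric : forall l, symmetric_op (res_proj l) ;
  res_min : forall (l m : R) (f : L2 mu),
    res_proj l (res_proj m f) = res_proj (Num.min l m) f %[ae mu] ;
  res_right_continuous : forall (l : R) (f : L2 mu),
    pnorm 2%:E (res_proj m f - res_proj l f) @[m --> l^'+] --> (0 : R) ;
  res_neg : forall (l : R) (f : L2 mu), l < 0 -> res_proj l f = cst 0 %[ae mu] ;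
  res_total : forall f : L2 mu,
    pnorm 2%:E (res_proj l f - f) @[l --> +oo] --> (0 : R) }.

End L2_space.

Section inner_theory.
Context d (X : measurableType d) (R : realType).
Variable mu : {measure set X -> \bar R}.
Implicit Types f g h : L2 mu.

Lemma L2_Lfun f : (f : X -> R) \in Lfun mu 2%:E.
Proof. exact: LfunP. Qed.

Lemma L2_mul_integrable f g : mu.-integrable setT (EFin \o (fun x => f x * g x)).
Proof. exact/Lfun1_integrable/(Lfun2_mul_Lfun1 (L2_Lfun f) (L2_Lfun g)). Qed.

Lemma innerC f g : inner mu f g = inner mu g f.
Proof. by rewrite /inner; under eq_Rintegral do rewrite mulrC. Qed.

Lemma innerBl f g h : inner mu (f - g) h = inner mu f h - inner mu g h.
Proof.
rewrite /inner -RintegralB//; try exact: L2_mul_integrable.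
by apply: eq_Rintegral => x _; rewrite -mulrBl.
Qed.

Lemma innerBr f g h : inner mu h (f - g) = inner mu h f - inner mu h g.
Proof. by rewrite innerC innerBl innerC [inner mu g h]innerC. Qed.

Lemma inner_ge0 f : 0 <= inner mu f f.
Proof. by apply: Rintegral_ge0 => x _; rewrite -expr2 sqr_ge0. Qed.

Lemma eq_ae_inner f g h : f = g %[ae mu] -> inner mu h f = inner mu h g.
Proof.
move=> fg; rewrite /inner /Rintegral; congr fine; apply: ae_eq_integral => //.
- exact: (measurable_int mu (L2_mul_integrable h f)).
- exact: (measurable_int mu (L2_mul_integrable h g)).
- by apply: filterS fg => x /(_ I) /= ->.
Qed.

Lemma inner_CauchySchwarz f g :
  `|inner mu f g| <= pnorm mu 2%:E f * pnorm mu 2%:E g.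
Proof.
have fin_norm h : (pnorm mu 2%:E h)%:E = 'N[mu]_2%:E[EFin \o h]%E.
  rewrite /pnorm fineK// fin_numElt (lt_le_trans ltNy0) ?Lnorm_ge0//=.
  exact: (@Lfunction_finite _ _ _ _ _ (lee1n 2) h).
have ifg := L2_mul_integrable f g.
apply: le_trans (le_normr_Rintegral measurableT ifg) _.
rewrite -lee_fin EFinM !fin_norm /Rintegral fineK; last first.
  exact/integrable_fin_num/integrable_norm.
have := @hoelder _ _ _ mu f g 2 2; rewrite Lnorm1; apply => //.
by rewrite [RHS]splitr !div1r.
Qed.

End inner_theory.

Section spectral_calculus.
Context d (X : measurableType d) (R : realType).
Variable mu : {measure set X -> \bar R}.
Variable E : resolution_of_identity mu.

Definition spectral_cdf (f : L2 mu) (l : R) : R := inner mu (E l f) f.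

Lemma inner_res (f : L2 mu) l m :
  inner mu (E l f) (E m f) = spectral_cdf f (Num.min l m).
Proof.
rewrite res_symmetric /spectral_cdf [RHS]innerC; apply: eq_ae_inner.
exact: res_min.
Qed.

Lemma spectral_cdf_nd f : nondecreasing (spectral_cdf f).
Proof.
move=> l m lm; rewrite -subr_ge0.
have := inner_ge0 (E m f - E l f).
rewrite innerBl !innerBr !inner_res !minxx [Num.min m l]minC (min_l lm).
by rewrite subrr subr0.
Qed.

Lemma spectral_cdf_rc f : right_continuous (spectral_cdf f).
Proof.
move=> l; apply/subr_cvg0.
have cvg0 : pnorm mu 2%:E (E m f - E l f) * pnorm mu 2%:E f @[m --> l^'+]
    --> (0 : R).
  rewrite -(mul0r (pnorm mu 2%:E f)); apply: cvgMl.
  exact: res_right_continuous.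
apply/norm_cvg0P; apply: (squeeze_cvgr _ (cvg_cst 0) cvg0).
apply/nearW => m; rewrite normr_ge0 /=.
by rewrite /spectral_cdf -innerBl; exact: inner_CauchySchwarz.
Qed.

HB.instance Definition _ f := isCumulative.Build R _ R (spectral_cdf f)
  (@spectral_cdf_nd f) (@spectral_cdf_rc f).

(* The measure d(E_l f, f); it does not charge the negative half-line. *)
Definition spectral_measure (f : L2 mu) :=
  lebesgue_stieltjes_measure (spectral_cdf f).

Definition spectral_dom (Psi : R -> R) (f : L2 mu) :=
  (\int[spectral_measure f]_(l in `[0%R, +oo[) (`|Psi l| ^+ 2)%:E < +oo)%E.

(* \int_0^oo Psi(l) d(E_l f, k) for f and k in the domain, by polarization: the
   signed measure d(E_l f, k) is a quarter of the difference of the finite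
   measures of f + k and f - k. *)
Definition spectral_form (Psi : R -> R) (f k : L2 mu) : R :=
  4^-1 * (\int[spectral_measure (f + k)]_(l in `[0, +oo[) Psi l
          - \int[spectral_measure (f - k)]_(l in `[0, +oo[) Psi l).

(* The operator \int_0^oo Psi(l) dE_l.  As its domain is dense, testing against
   k in the domain determines h up to almost everywhere equality. *)
Definition spectral_integral (Psi : R -> R) : unbounded_op mu := fun f h =>
  spectral_dom Psi f /\
  forall k, spectral_dom Psi k -> inner mu h k = spectral_form Psi f k.

End spectral_calculus.

Section functional_inequalities.
Context d (X : measurableType d) (R : realType).
Variable mu : {measure set X -> \bar R}.

Definition spectral_resolution_of (A : unbounded_op mu)
    (E : resolution_of_identity mu) :=
  forall f h, A f h <-> spectral_integral E (fun l => l) f h.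

(* Psi(A), for Psi Borel and A non-negative self-adjoint: such an A has a spectral
   resolution, which is unique up to almost everywhere equality. *)
Definition op_fun (Psi : R -> R) (A : unbounded_op mu) : unbounded_op mu :=
  fun f h => exists2 E, spectral_resolution_of A E & spectral_integral E Psi f h.

Definition super_poincare (B : unbounded_op mu) (r0 r1 : \bar R)
    (beta : R -> R) :=
  forall f h : L2 mu, B f h -> (f : X -> R) \in Lfun mu 1 ->
  forall r : R, (r0 < r%:E < r1)%E ->
    pnorm mu 2%:E f ^+ 2 <= r * inner mu h f + beta r * pnorm mu 1 f ^+ 2.

End functional_inequalities.

Section Bernstein.
Context (R : realType).
Implicit Types g : R -> R.

(* Only the values of g on ]0, +oo[ matter. *)
Record bernstein g : Prop := {
  bernstein_gt0 : forall s : R, 0 < s -> 0 < g s ;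
  bernstein_smooth : forall n (s : R), 0 < s -> derivable (derive1n n g : R -> R) s 1 ;
  bernstein_sign : forall n (s : R), (1 <= n)%N -> 0 < s ->
    0 <= (-1) ^+ n.-1 * derive1n n g s }.

Definition lim_zero g : \bar R := lim ((g s)%:E @[s --> 0^'+]).

Definition lim_infty g : \bar R := lim ((g s)%:E @[s --> +oo]).

Definition ext_zero g (l : R) : R := if 0 < l then g l else fine (lim_zero g).

Definition inv_pos g : R -> R := 'pinv_(fun=> 0) `]0, +oo[ g.

End Bernstein.

(* Main.v *)
Require Import Defs.
From HB Require Import structures.
From mathcomp Require Import all_boot all_order all_algebra.
From mathcomp Require Import all_classical all_reals all_analysis.
From mathcomp Require Import measurable_realfun ring lra.

(** The inequality is first proved for powers of the resolvent of [A], then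
    transferred to [g (A)] by writing [g] as a limit of mixtures of splines.

    Let [x > 0] be such that [g x = 1 / r], and put [F = |f|_2^2],
    [B = beta (1 / x) |f|_1^2].  It has to be shown that
    [int g d mu_f >= g x * (F - B)], where [mu_f] is the spectral measure of [f].
    Only the case [B <= F] matters, since the left-hand side is nonnegative.

    The resolvent [(1 + sigma A)^-1] maps [f] into the domain of [A]
    ([resolvent_riesz], [resolvent_spectral_integral]) and contracts the first
    norm, as [A] generates a semigroup of contractions for that norm
    ([resolvent_pnorm1]).  If [u + sigma A u = f], expanding [|f|_2^2] and using the
    super-Poincare inequality for [u] at [1 / x] gives
    [|u|_2^2 - B <= (F - B) / (1 + 2 sigma x)].  Iterating [k] times with
    [sigma = 1 / (2 s)] yields
    [int (1 + l / (2 s))^(-2 k) d mu_f (l) <= B + (F - B) (1 + x / s)^(-k)]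
    ([resolvent_powers]).  The integrand dominates the spline [(1 - l / s)_+^k],
    and for large [k] or large [s] the right-hand side is hardly larger than
    [B + (F - B) (1 - x / s)_+^k] ([resolvent_power_le]).  Up to a small error,
    the inequality therefore holds for all functions
    [l |-> 1 - (1 - l / s)_+^k] in place of [g].

    Taylor's formula with integral remainder at a far point [M] expresses
    [g M - g] on [0, M] as a mixture of splines, with nonnegative weights because
    the derivatives of a Bernstein function alternate in sign
    ([bernstein_taylor_pos]).  Tonelli's theorem and a passage to the limit then
    give the inequality for [g] ([bernstein_integral_ge]). *)

Set Implicit Arguments.
Unset Strict Implicit.
Unset Printing Implicit Defensive.

Import Order.TTheory GRing.Theory Num.Theory.
Import numFieldNormedType.Exports.

Local Open Scope classical_set_scope.
Local Open Scope ring_scope.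

(** * Square-integrable functions: completeness, Riesz representation, closed balls of the first norm *)

Section L2_geometry.
Context d (X : measurableType d) (R : realType).
Variable mu : {measure set X -> \bar R}.
Implicit Types (f g h : L2 mu) (a C : R).

Lemma innerDl f g h : inner mu (f + g) h = inner mu f h + inner mu g h.
Proof.
rewrite /inner -RintegralD//; try exact: L2_mul_integrable.
by apply: eq_Rintegral => x _; rewrite -mulrDl.
Qed.

Lemma innerDr f g h : inner mu h (f + g) = inner mu h f + inner mu h g.
Proof. by rewrite innerC innerDl innerC [inner mu g h]innerC. Qed.

Lemma innerZl a f h : inner mu (a *: f) h = a * inner mu f h.
Proof.
rewrite /inner -RintegralZl//; try exact: L2_mul_integrable.
by apply: eq_Rintegral => x _; rewrite mulrA.
Qed.

Lemma innerZr a f h : inner mu h (a *: f) = a * inner mu h f.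
Proof. by rewrite innerC innerZl innerC. Qed.

Definition innerE := (innerBl, innerBr, innerDl, innerDr, innerZl, innerZr).

Lemma pnorm_ge0 p (f : X -> R) : 0 <= pnorm mu p f.
Proof. by rewrite /pnorm fine_ge0// Lnorm_ge0. Qed.

Lemma integral_sqr f : (\int[mu]_x ((f x) ^+ 2)%:E)%E = (inner mu f f)%:E.
Proof.
rewrite /inner /Rintegral fineK.
  by apply: eq_integral => x _; rewrite expr2.
apply: integrable_fin_num => //; exact: L2_mul_integrable.
Qed.

Lemma sqr_pnorm2 f : pnorm mu 2%:E f ^+ 2 = inner mu f f.
Proof.
apply: EFin_inj; rewrite -integral_sqr /pnorm -powR_mulrn ?fine_ge0 ?Lnorm_ge0//.
rewrite -poweR_EFin fineK; last first.
  by rewrite ge0_fin_numE ?Lnorm_ge0//; exact: (@Lfunction_finite _ _ _ _ _ (lee1n 2) f).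
rewrite (@powR_Lnorm _ _ _ mu (EFin \o f) 2)//.
by apply: eq_integral => x _; rewrite /= powR_mulrn// real_normK ?num_real.
Qed.

Lemma pnorm2E f : pnorm mu 2%:E f = Num.sqrt (inner mu f f).
Proof. by rewrite -sqr_pnorm2 sqrtr_sqr ger0_norm// pnorm_ge0. Qed.

Lemma ler_pnormD f g :
  pnorm mu 2%:E (f + g) <= pnorm mu 2%:E f + pnorm mu 2%:E g.
Proof. exact: ler_LnormD. Qed.

Lemma pnormZ a f : pnorm mu 2%:E (a *: f) = `|a| * pnorm mu 2%:E f.
Proof.
by rewrite !pnorm2E !innerE mulrA -expr2 sqrtrM ?sqr_ge0// sqrtr_sqr.
Qed.

Lemma pnorm_ae_eq f g : f = g %[ae mu] -> pnorm mu 2%:E f = pnorm mu 2%:E g.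
Proof.
by move=> fg; rewrite !pnorm2E (eq_ae_inner _ fg) innerC (eq_ae_inner _ fg).
Qed.

Lemma ge0_fatou_ae (w : nat -> X -> R) (v : X -> R) C :
  (forall n, measurable_fun setT (w n)) -> (forall n x, 0 <= w n x) ->
  measurable_fun setT v ->
  (forall n, (\int[mu]_x (w n x)%:E <= C%:E)%E) ->
  {ae mu, forall x, w ^~ x @ \oo --> v x} ->
  (\int[mu]_x (v x)%:E <= C%:E)%E.
Proof.
move=> mw w0 mv wC wv.
pose e : X -> \bar R := fun x => limn_einf (fun n => (w n x)%:E).
have me : measurable_fun [set: X] e.
  rewrite (_ : e = fun x => (- limn_esup (fun n => (- w n x)%:E))%E).
    apply: measurableT_comp => //; apply: measurable_fun_limn_esup => n.
    apply/measurable_EFinP; exact: measurableT_comp.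
  by apply/funext => x; rewrite -limn_einfN /comp /=; congr limn_einf; apply/funext => n; rewrite /= opprK.
rewrite (ae_eq_integral e)//; last 2 first.
- exact/measurable_EFinP.
- apply: filterS wv => x /= wvx _.
  by rewrite /e; have /cvg_limn_einf_sup[-> _] : (fun n => (w n x)%:E) @ \oo --> (v x)%:E
    by apply/cvg_EFin => //; exact: nearW.
apply: le_trans.
  apply: fatou => // n; [exact/measurable_EFinP|by move=> x _; rewrite lee_fin].
rewrite limn_einf_lim; apply: lime_le.
  exact: is_cvg_einfs.
apply: nearW => n; rewrite /einfs.
apply: le_trans (wC n); apply: ereal_inf_lbound; exists n => //=.
Qed.

(** Summing the weighted squares [4 ^+ n * v_n ^+ 2], whose integrals form a
    convergent geometric series, gives a function that is finite almost
    everywhere; its value at [x] bounds every term at [x]. *)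
Lemma fast_cvg_ae (v : nat -> L2 mu) C :
  (forall n, pnorm mu 2%:E (v n) <= C * 4^-1 ^+ n) ->
  {ae mu, forall x, exists K : R, forall n, `|v n x| <= K * 2^-1 ^+ n}.
Proof.
move=> vC.
have mf n : measurable_fun [set: X] (fun x => (4 ^+ n * (v n x) ^+ 2)%:E).
  apply/measurable_EFinP; apply: measurable_funM => //.
  exact: measurable_funX.
pose G : X -> \bar R := fun x => (\sum_(n <oo) (4 ^+ n * (v n x) ^+ 2)%:E)%E.
have f0 n x : (0 <= (4 ^+ n * (v n x) ^+ 2)%:E)%E.
  by rewrite lee_fin mulr_ge0 ?sqr_ge0// exprn_ge0.
have G0 x : (0 <= G x)%E by apply: nneseries_ge0.
have mG : measurable_fun setT G.
  by apply: ge0_emeasurable_sum.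
have iG : (\int[mu]_x G x < +oo)%E.
  rewrite /G integral_nneseries//.
  apply: (@le_lt_trans _ _ (\sum_(n <oo) (C ^+ 2 * 4^-1 ^+ n)%:E)%E); last first.
    apply: (@le_lt_trans _ _ (C ^+ 2 * 2)%:E); last exact: ltry.
    apply: lime_le.
      by apply: is_cvg_nneseries => n _ _; rewrite lee_fin mulr_ge0 ?sqr_ge0 ?exprn_ge0.
    apply: nearW => n; rewrite sumEFin lee_fin -mulr_sumr ler_wpM2l ?sqr_ge0//.
    have -> : \sum_(0 <= i < n) (4^-1 : R) ^+ i = 4 / 3 * (1 - 4^-1 ^+ n).
      elim: n => [|n IH]; first by rewrite big_geq// expr0 subrr mulr0.
      by rewrite big_nat_recr//= IH exprS; field.
    have : (0 : R) <= 4^-1 ^+ n by rewrite exprn_ge0.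
    lra.
  apply: lee_nneseries => n _.
    by move=> *; apply: integral_ge0 => *; exact: f0.
  rewrite (_ : (fun x => _) = (fun x => ((4 ^+ n)%:E * ((v n x) ^+ 2)%:E)%E))//.
  rewrite ge0_integralZl//; last 2 first.
  - by apply/measurable_EFinP; exact: measurable_funX.
  - by move=> x _; rewrite lee_fin sqr_ge0.
  rewrite integral_sqr -EFinM lee_fin -sqr_pnorm2.
  have Cn0 : 0 <= C * 4^-1 ^+ n := le_trans (pnorm_ge0 2%:E (v n)) (vC n).
  have : pnorm mu 2%:E (v n) ^+ 2 <= (C * 4^-1 ^+ n) ^+ 2.
    by rewrite lerXn2r ?nnegrE ?pnorm_ge0.
  move=> /(ler_wpM2l (exprn_ge0 n (ler0n R 4))) /le_trans; apply.
  by rewrite exprMn mulrCA ler_wpM2l ?sqr_ge0// expr2 mulrA -exprMn divff// expr1n mul1r.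
have : {ae mu, forall x, setT x -> G x \is a fin_num}.
  apply: integrable_ae => //; apply/integrableP; split => //.
  by under eq_integral do rewrite gee0_abs//.
apply: filterS => x /(_ I) Gx.
exists (Num.sqrt (fine (G x))) => n.
have Hn : 4 ^+ n * (v n x) ^+ 2 <= fine (G x).
  rewrite -lee_fin fineK// /G.
  have /= := @nneseries_lim_ge R (fun n => (4 ^+ n * (v n x) ^+ 2)%:E) xpredT 0 n.+1.
  move=> /(_ (fun k _ _ => f0 k x)); apply: le_trans.
  rewrite big_nat_recr//= leeDr//; exact: sume_ge0.
rewrite -ler_sqr ?nnegrE ?mulr_ge0 ?sqrtr_ge0 ?exprn_ge0//.
rewrite exprMn sqr_sqrtr ?fine_ge0// real_normK ?num_real//.
rewrite -exprM mulnC exprM -(ler_pM2l (x := 4 ^+ n)) ?exprn_gt0//.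
rewrite [leRHS]mulrCA -exprMn (_ : 4 * 2^-1 ^+ 2 = 1) ?expr1n ?mulr1//.
by rewrite expr2; field.
Qed.

(** Turns a concrete square-integrable function, such as a pointwise limit, into
    an element of [L2 mu]. *)
Lemma L2_of_sqr_integral (f : X -> R) C : measurable_fun setT f ->
  (\int[mu]_x ((f x) ^+ 2)%:E <= C%:E)%E -> exists u : L2 mu, forall x, u x = f x.
Proof.
move=> mf fC.
have fL : f \in Lfun mu 2%:E.
  rewrite inE; apply/andP; split; rewrite inE//=.
  rewrite /finite_norm unlock /=; apply: poweR_lty.
  apply: le_lt_trans (ltry C); apply: le_trans fC.
  under eq_integral do rewrite powR_mulrn// real_normK ?num_real//.
  exact: lexx.
by exists (Lfun_Sub (lee1n 2) fL).
Qed.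

(** Riesz-Fischer theorem for fast Cauchy sequences: consecutive differences are
    summable almost everywhere by [fast_cvg_ae], and Fatou's lemma turns the
    pointwise limit into a limit in norm. *)
Lemma L2_complete (v : nat -> L2 mu) C :
  (forall n, pnorm mu 2%:E (v n.+1 - v n) <= C * 4^-1 ^+ n) ->
  exists u : L2 mu, forall n, pnorm mu 2%:E (u - v n) <= 2 * C * 4^-1 ^+ n.
Proof.
move=> vC.
have C0 : 0 <= C.
  by have := vC 0%N; rewrite expr0 mulr1; apply: le_trans; exact: pnorm_ge0.
have Cn0 n : 0 <= 2 * C * 4^-1 ^+ n by rewrite !mulr_ge0 ?exprn_ge0.
have tele m n : pnorm mu 2%:E (v (n + m)%N - v n) <= 2 * C * 4^-1 ^+ n * (1 - 4^-1 ^+ m).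
  elim: m => [|m IH]; first by rewrite addn0 subrr -(scale0r (v n)) pnormZ normr0 mul0r expr0 subrr mulr0.
  rewrite addnS -(subrKA (v (n + m)%N)).
  apply: le_trans (ler_pnormD _ _) _.
  apply: le_trans (lerD (vC _) IH) _.
  rewrite exprD exprS.
  have p1 : 0 <= C * (4^-1 ^+ n * 4^-1 ^+ m) by rewrite !mulr_ge0 ?exprn_ge0.
  lra.
have teleC m n : pnorm mu 2%:E (v (n + m)%N - v n) <= 2 * C * 4^-1 ^+ n.
  apply: le_trans (tele _ _) _; by rewrite ler_piMr// gerBl exprn_ge0.
pose u : X -> R := fun x => fine (limn_esup (fun n => (v n x)%:E)).
have mu_ : measurable_fun setT u.
  apply: measurableT_comp => //; apply: measurable_fun_limn_esup => n.
  exact/measurable_EFinP.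
(* the superior limit is measurable, and it is the limit where that exists *)
have cu : {ae mu, forall x, v ^~ x @ \oo --> u x}.
  have := fast_cvg_ae vC; apply: filterS => x [K HK].
  have : cvgn (v ^~ x).
    have cs : cvgn (series (fun n => v n.+1 x - v n x)).
      apply: normed_cvg; apply: (series_le_cvg (v_ := geometric K 2^-1)) => //.
      - by move=> n /=; rewrite normr_ge0.
      - move=> n; rewrite /geometric /= mulr_ge0 ?exprn_ge0//.
        by have := HK 0%N; rewrite expr0 mulr1; apply: le_trans.
      - by apply: is_cvg_geometric_series; rewrite ger0_norm//; lra.
    rewrite (_ : v ^~ x = (fun n => v 0%N x + series (fun n => v n.+1 x - v n x) n)).
      by apply: is_cvgD => //; exact: is_cvg_cst.
    apply/funext => n; rewrite /series /= telescope_sumr//.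
    by rewrite addrC subrK.
  move=> /cvg_ex[l vl].
  suff -> : u x = l by [].
  rewrite /u; have /cvg_limn_einf_sup[_ ->//] : (fun n => (v n x)%:E) @ \oo --> l%:E.
  by apply/cvg_EFin => //; exact: nearW.
have fat n : (\int[mu]_x ((u x - v n x) ^+ 2)%:E <= ((2 * C * 4^-1 ^+ n) ^+ 2)%:E)%E.
  apply: (@ge0_fatou_ae (fun m x => (v (n + m)%N x - v n x) ^+ 2)).
  - by move=> m; apply: measurable_funX; exact: measurable_funB.
  - by move=> m x; rewrite sqr_ge0.
  - by apply: measurable_funX; exact: measurable_funB.
  - move=> m; rewrite [X in (X <= _)%E](integral_sqr (v (n + m)%N - v n)).
    by rewrite -sqr_pnorm2 lee_fin lerXn2r ?nnegrE ?pnorm_ge0.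
  - apply: filterS cu => x vx.
    have cd : v (n + m)%N x - v n x @[m --> \oo] --> u x - v n x.
      apply: cvgB; last exact: cvg_cst.
      under eq_fun do rewrite addnC.
      by have := vx; rewrite -(cvg_shiftn n).
    by under eq_fun do rewrite expr2; rewrite expr2; exact: cvgM.
have [z zE] := L2_of_sqr_integral (measurable_funB mu_ (measurable_funP (v 0%N))) (fat 0%N).
exists (z + v 0%N) => n.
rewrite -(@ler_pXn2r _ 2) ?nnegrE ?pnorm_ge0// sqr_pnorm2 -lee_fin -integral_sqr.
apply: le_trans (fat n).
have E x : (z + v 0%N - v n) x = u x - v n x.
  rewrite [LHS]/(z x + v 0%N x - v n x) zE.
  exact: (congr1 (fun t => t - v n x) (subrK (v 0%N x) (u x))).
by under eq_integral do rewrite E.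
Qed.

Lemma ler_addgt0_geometric (a b K : R) :
  (forall n, a <= b + K * 4^-1 ^+ n) -> a <= b.
Proof.
move=> H.
have cv : b + K * 4^-1 ^+ n @[n --> \oo] --> b.
  rewrite -[X in _ --> X]addr0; apply: cvgD; first exact: cvg_cst.
  by apply: cvg_geometric; rewrite ger0_norm//; lra.
rewrite -(cvg_lim _ cv)//; apply: limr_ge; first by apply/cvg_ex; exists b.
exact: nearW.
Qed.

(** [h] minimizes the energy [|f|^2 - 2 phi f].  The parallelogram identity makes
    a minimizing sequence Cauchy, and the first variation at the minimum is the
    representation formula. *)
Lemma L2_riesz (phi : L2 mu -> R) C :
  (forall a f g, phi (a *: f + g) = a * phi f + phi g) ->
  (forall f, `|phi f| <= C * pnorm mu 2%:E f) ->
  exists h, forall f, inner mu h f = phi f.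
Proof.
move=> phil phiC.
have phi0 : phi 0 = 0.
  have := phil 1 0 0; rewrite scaler0 add0r mul1r => /eqP.
  by rewrite -subr_eq0 opprD addrA subrr sub0r oppr_eq0 => /eqP.
have phiZ a f : phi (a *: f) = a * phi f by rewrite -[a *: f]addr0 phil phi0 addr0.
have phiD f g : phi (f + g) = phi f + phi g by have := phil 1 f g; rewrite scale1r mul1r.
pose J f := inner mu f f - 2 * phi f.
have Jlb f : - C ^+ 2 <= J f.
  rewrite /J -sqr_pnorm2.
  have := le_trans (ler_norm _) (phiC f).
  have := sqr_ge0 (pnorm mu 2%:E f - C).
  rewrite sqrrB; lra.
have hi : has_inf (range J).
  by split; [exists (J 0), 0|exists (- C ^+ 2) => _ [f _ <-]; exact: Jlb].
pose m := inf (range J).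
have mJ f : m <= J f by apply: ge_inf; [exact: hi.2|exists f].
have ex n : exists f, J f <= m + 16^-1 ^+ n.
  have e0 : 0 < (16^-1 : R) ^+ n by rewrite exprn_gt0//; lra.
  have [_ [f _ <-] /ltW fm] := inf_adherent e0 hi.
  by exists f.
have [v vm] := choice ex.
have par f g : inner mu (f - g) (f - g) = 2 * J f + 2 * J g - 4 * J (2^-1 *: (f + g)).
  rewrite /J phiZ phiD !innerE (innerC g f); lra.
have vC n : pnorm mu 2%:E (v n.+1 - v n) <= 2 * 4^-1 ^+ n.
  rewrite -(@ler_pXn2r _ 2) ?nnegrE ?pnorm_ge0// ?mulr_ge0 ?exprn_ge0// sqr_pnorm2 par.
  have -> : (2 * 4^-1 ^+ n : R) ^+ 2 = 4 * 16^-1 ^+ n.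
    rewrite exprMn -exprM mulnC exprM; congr (_ * _); first by rewrite expr2; lra.
    by congr (_ ^+ n); rewrite expr2; field.
  have := vm n; have := vm n.+1; have := mJ (2^-1 *: (v n.+1 + v n)).
  rewrite exprS; have : (0 : R) <= 16^-1 ^+ n by rewrite exprn_ge0.
  lra.
have [h hv] := L2_complete vC.
have Jh : J h <= m.
  pose N := pnorm mu 2%:E.
  have C0 : 0 <= C * N h by apply: le_trans (phiC h).
  apply: (@ler_addgt0_geometric _ _ (49 + 8 * N h + 8 * `|C|)) => n.
  set q := 4^-1 ^+ n.
  have q0 : 0 <= q by rewrite exprn_ge0.
  have q1 : q <= 1 by rewrite exprn_ile1//; lra.
  have qq : q * q <= q by rewrite ler_piMr.
  have dn : N (h - v n) <= 4 * q by have := hv n; rewrite -/q -/(N _); lra.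
  have N0 : 0 <= N (h - v n) := pnorm_ge0 _ _.
  have Nh0 : 0 <= N h := pnorm_ge0 _ _.
  have Jhn : J h = J (v n) + 2 * inner mu h (h - v n)
      - inner mu (h - v n) (h - v n) - 2 * phi (h - v n).
    rewrite /J (_ : phi (h - v n) = phi h - phi (v n)); last first.
      by rewrite phiD -scaleN1r phiZ mulN1r.
    rewrite !innerE (innerC (v n) h); lra.
  have c1 : inner mu h (h - v n) <= N h * (4 * q).
    apply: le_trans (ler_norm _) _; apply: le_trans (inner_CauchySchwarz _ _) _.
    exact: ler_wpM2l.
  have c2 : - phi (h - v n) <= `|C| * (4 * q).
    apply: le_trans (ler_norm _) _; rewrite normrN; apply: le_trans (phiC _) _.
    exact: le_trans (ler_wpM2r N0 (ler_norm C)) (ler_wpM2l (normr_ge0 C) dn).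
  have c3 := inner_ge0 (h - v n).
  have vn := vm n.
  have q16 : 16^-1 ^+ n <= q by rewrite lerXn2r ?nnegrE//; lra.
  nra.
exists h => k.
(* a nonnegative quadratic polynomial without constant term has no linear term *)
have qf t : 0 <= t ^+ 2 * inner mu k k + 2 * t * (inner mu h k - phi k).
  have := le_trans Jh (mJ (h + t *: k)).
  rewrite /J phiD phiZ !innerE (innerC k h); lra.
set D := inner mu h k - phi k; set Q := inner mu k k.
suff : D = 0 by move=> /eqP; rewrite subr_eq0 => /eqP.
have Q0 : 0 <= Q := inner_ge0 k.
have := qf (- D / (Q + 1)); rewrite -/D -/Q => H.
have Q1 : 0 < Q + 1 by lra.
have E : (- D / (Q + 1)) ^+ 2 * Q + 2 * (- D / (Q + 1)) * D =
  - (D ^+ 2) * ((Q + 2) / (Q + 1) ^+ 2) by field; lra.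
move: H; rewrite E mulNr oppr_ge0 pmulr_lle0; last by rewrite divr_gt0 ?exprn_gt0//; lra.
by move=> D2; apply/eqP; rewrite -sqrf_eq0 eq_le D2 sqr_ge0.
Qed.

Lemma integral_norm_pnorm1 (f : X -> R) : f \in Lfun mu 1 ->
  (\int[mu]_x `|f x|%:E)%E = (pnorm mu 1 f)%:E.
Proof.
move=> /Lfun1_integrable fi; rewrite /pnorm Lnorm1 fineK//.
exact/integrable_fin_num/integrable_abse.
Qed.

Lemma pnorm1_le (f : X -> R) C : measurable_fun setT f ->
  (\int[mu]_x `|f x|%:E <= C%:E)%E ->
  f \in Lfun mu 1 /\ pnorm mu 1 f <= C.
Proof.
move=> mf fC.
have fL : f \in Lfun mu 1.
  apply/Lfun1_integrable/integrableP; split; first exact/measurable_EFinP.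
  exact: le_lt_trans fC (ltry _).
by split => //; rewrite -lee_fin -integral_norm_pnorm1.
Qed.

Lemma pnorm1_lin a b (f g : L2 mu) :
  (f : X -> R) \in Lfun mu 1 -> (g : X -> R) \in Lfun mu 1 ->
  ((a *: f + b *: g : L2 mu) : X -> R) \in Lfun mu 1 /\
  pnorm mu 1 (a *: f + b *: g) <= `|a| * pnorm mu 1 f + `|b| * pnorm mu 1 g.
Proof.
move=> fL gL; apply: pnorm1_le => //.
rewrite [leRHS]EFinD [in leRHS]EFinM [X in (_ + X)%E]EFinM -!integral_norm_pnorm1//.
have mn (k : L2 mu) : measurable_fun [set: X] (fun x => `|k x|%:E).
  by apply/measurable_EFinP; exact: measurableT_comp.
have mz (c : R) (k : L2 mu) : measurable_fun [set: X] (fun x => (`|c|%:E * `|k x|%:E)%E).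
  by apply: emeasurable_funM => //; exact: mn.
rewrite -!ge0_integralZl// -ge0_integralD//; try by move=> x _; rewrite ?mule_ge0.
  apply: ge0_le_integral => //.
  - by apply: emeasurable_funD; exact: mz.
  - by move=> x _; rewrite -!EFinM -EFinD lee_fin -!normrM; exact: ler_normD.
Qed.

(** Balls of the first norm are closed for convergence in [L2]: Fatou's lemma
    along an almost everywhere convergent sequence. *)
Lemma pnorm1_lsc (u : L2 mu) (p : nat -> L2 mu) C (K : R) :
  (forall n, pnorm mu 2%:E (u - p n) <= C * 4^-1 ^+ n) ->
  (forall n, (p n : X -> R) \in Lfun mu 1 /\ pnorm mu 1 (p n) <= K) ->
  (u : X -> R) \in Lfun mu 1 /\ pnorm mu 1 u <= K.
Proof.
move=> upC pK; apply: pnorm1_le => //.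
apply: (@ge0_fatou_ae (fun n x => `|p n x|)) => //.
- by move=> n; exact: measurableT_comp.
- exact: measurableT_comp.
- by move=> n; rewrite integral_norm_pnorm1 ?lee_fin; have [] := pK n.
- have := fast_cvg_ae upC; apply: filterS => x [M HM].
  apply: cvg_norm; apply/subr_cvg0.
  apply/norm_cvg0P; apply: (squeeze_cvgr _ (cvg_cst 0)).
    apply: nearW => n; rewrite normr_ge0/= distrC; exact: HM.
  by apply: cvg_geometric; rewrite ger0_norm//; lra.
Qed.

(** The resolvent, mapping [u + sigma A u] to [u], contracts the first norm.  For
    small [t > 0], up to an error that vanishes with [t], [u] is the fixed point
    of [p |-> al f + (1 - al) T_t p] where [f] is [u + sigma A u] and
    [al = t / (t + sigma)].  The iterates of this map started at [0] never leave
    the ball of radius [|f|_1], and they approach [u] in [L2]. *)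
Lemma resolvent_pnorm1 (T : R -> L2 mu -> L2 mu) (u h : L2 mu) (sigma : R) :
  contraction_semigroup T -> 0 < sigma -> neg_generator T u h ->
  ((u + sigma *: h : L2 mu) : X -> R) \in Lfun mu 1 ->
  (u : X -> R) \in Lfun mu 1 /\ pnorm mu 1 u <= pnorm mu 1 (u + sigma *: h).
Proof.
move=> TS s0 Auh; set f := u + sigma *: h => fL.
pose N (k : L2 mu) := pnorm mu 2%:E k.
have approx e : 0 < e -> exists p : L2 mu,
    [/\ (p : X -> R) \in Lfun mu 1, pnorm mu 1 p <= pnorm mu 1 f & N (u - p) <= e].
  move=> e0.
  have es0 : 0 < e / 2 / sigma by rewrite !divr_gt0.
  have [t t0 te] : exists2 t, 0 < t & N (t^-1 *: (T t u - u) + h) <= e / 2 / sigma.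
    have /cvgrPdist_le /(_ _ es0) H := Auh.
    near (0 : R)^'+ => t; exists t => //.
    have : `|0 - N (t^-1 *: (T t u - u) + h)| <= e / 2 / sigma by near: t.
    by rewrite sub0r normrN ger0_norm// pnorm_ge0.
  set r := _ + h in te.
  pose al := t / (t + sigma).
  have al0 : 0 < al by rewrite divr_gt0// addr_gt0.
  have al1 : al < 1 by rewrite ltr_pdivrMr ?addr_gt0// mul1r ltrDl.
  have al1' : 0 <= 1 - al by rewrite subr_ge0 ltW.
  have uE : u = al *: f + (1 - al) *: T t u - (al * sigma) *: r.
    apply/LfuneqP => x.
    have E (y z k : R) : y = al * (y + sigma * k) + (1 - al) * z
        - (al * sigma) * (t^-1 * (z - y) + k).
      by rewrite /al; field; rewrite !gt_eqF// addr_gt0.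
    exact: E.
  pose p j := iter j (fun p => al *: f + (1 - al) *: T t p) 0.
  have pL j : (p j : X -> R) \in Lfun mu 1 /\ pnorm mu 1 (p j) <= pnorm mu 1 f.
    elim: j => [|j [pjL pj]].
      apply: pnorm1_le => //.
      rewrite (eq_integral (cst 0%E)); last by move=> x _; rewrite [X in `|X|](_ : _ = 0) ?normr0.
      by rewrite integral0 lee_fin pnorm_ge0.
    have TL := semigroup_L1 TS t0 pjL.
    have [L le] := pnorm1_lin al (1 - al) fL TL; split => //.
    apply: le_trans le _; rewrite (ger0_norm al1') (ger0_norm (ltW al0)).
    have := ler_wpM2l al1' (le_trans (semigroup_contraction1 TS t0 pjL) pj).
    lra.
  have pN j : N (u - p j) <= (1 - al) ^+ j * N u + e / 2.
    elim: j => [|j IH]; first by rewrite /= subr0 expr0 mul1r lerDl ltW// divr_gt0.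
    have Tlin : N (T t u - T t (p j)) <= N (u - p j).
      rewrite (addrC (T t u)) -scaleN1r.
      rewrite /N -(pnorm_ae_eq (semigroup_linear TS t0 _ _ _)).
      by apply: le_trans (semigroup_contraction2 TS _ t0) _; rewrite scaleN1r addrC.
    have -> : u - p j.+1 = (1 - al) *: (T t u - T t (p j)) + (- (al * sigma)) *: r.
      by rewrite {1}uE /= scalerBr scaleNr opprD addrACA addrA (addrAC (al *: f)) subrr add0r addrAC.
    apply: le_trans (ler_pnormD _ _) _.
    rewrite !pnormZ normrN (ger0_norm al1') (ger0_norm (mulr_ge0 (ltW al0) (ltW s0))).
    rewrite -/(N _) -/(N r).
    have : sigma * N r <= e / 2.
      by rewrite -ler_pdivlMl// mulrC.
    rewrite exprS; set q := (1 - al) ^+ j in IH *.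
    move=> sr; have := ler_wpM2l al1' (le_trans Tlin IH).
    have := ler_wpM2l (ltW al0) sr.
    lra.
  have [j jE] : exists j, (1 - al) ^+ j * N u <= e / 2.
    have : N u * (1 - al) ^+ j @[j --> \oo] --> (0 : R).
      by apply: cvg_geometric; rewrite ger0_norm ?subr_ge0 ?ltW// gtrBl.
    move=> /cvgrPdist_le /(_ (e / 2)) []; first by rewrite divr_gt0.
    move=> j _ /(_ j (leqnn j)) /=; rewrite sub0r normrN mulrC => H.
    by exists j; exact: le_trans (ler_norm _) H.
  have [pjL pj] := pL j; exists (p j); split => //.
  by apply: le_trans (pN j) _; rewrite [leRHS]splitr lerD2r.
have ex n : exists p : L2 mu,
    [/\ (p : X -> R) \in Lfun mu 1, pnorm mu 1 p <= pnorm mu 1 f & N (u - p) <= 4^-1 ^+ n].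
  by apply: approx; rewrite exprn_gt0//; lra.
have [p pP] := choice ex.
apply: (@pnorm1_lsc u p 1) => n; have [pL p1 pu] := pP n.
  by rewrite mul1r.
by split.
Unshelve. all: by end_near. Qed.

End L2_geometry.

(** * Layer-cake formula *)

Section layer_cake.
Context (R : realType).
Variable nu : {sigma_finite_measure set (measurableTypeR R) -> \bar R}.
Local Notation leb := (@lebesgue_measure R).

(** Tonelli's theorem on the region [0 <= t < l], for a primitive [eta] of [rho]
    that vanishes at the origin.  It expresses integrals against a
    Lebesgue-Stieltjes measure through its tails, which for spectral measures are
    quadratic forms. *)
Lemma layer_cake (q eta rho : R -> R) :
  measurable_fun setT q -> measurable_fun setT rho ->
  (forall l, 0 <= l -> 0 <= q l) -> (forall l, 0 <= l -> 0 <= rho l) ->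
  (forall l, 0 <= l -> (\int[leb]_(t in `[0%R, l[) (rho t)%:E = (eta l)%:E)%E) ->
  (\int[nu]_(l in `[0%R, +oo[) (q l * eta l)%:E =
   \int[leb]_(t in `[0%R, +oo[) ((rho t)%:E * \int[nu]_(l in `]t, +oo[) (q l)%:E))%E.
Proof.
move=> mq mrho q0 rho0 etaE.
pose A := [set z : measurableTypeR R * measurableTypeR R | 0 <= z.2 < z.1].
have mA : measurable A.
  rewrite (_ : A = (fun z => 0 <= z.2) @^-1` [set true]
       `&` (fun z => z.2 < z.1) @^-1` [set true]); last first.
    by apply/seteqP; split => [z /andP[]|z [h1 h2]] //; exact/andP.
  by apply: measurableI; rewrite -[_ @^-1` _]setTI;
    [apply: measurable_fun_ler|apply: measurable_fun_ltr].
pose F (z : measurableTypeR R * measurableTypeR R) : \bar R :=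
  (`|q z.1| * `|rho z.2| * \1_A z)%:E.
have mF : measurable_fun setT F.
  apply/measurable_EFinP; apply: measurable_funM.
    by apply: measurable_funM; apply: measurableT_comp => //; apply: measurableT_comp.
  exact: measurable_indic.
have F0 z : (0 <= F z)%E by rewrite lee_fin !mulr_ge0.
have := fubini_tonelli (m1 := nu) (m2 := leb) F mF F0.
rewrite [X in _ = X -> _](_ : _ = \int[leb]_(t in `[0%R, +oo[)
    ((rho t)%:E * \int[nu]_(l in `]t, +oo[) (q l)%:E))%E.
  move=> <-; rewrite integral_mkcond; apply: eq_integral => l _.
  rewrite patchE; case: ifPn => [|]; rewrite ?(inE, notin_setE)/= in_itv/= andbT.
    move=> l0; rewrite EFinM -etaE// -ge0_integralZl//; last 3 first.
    - exact/measurable_EFinP/measurable_funTS.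
    - by move=> t; rewrite /= in_itv/= => /andP[t0 _]; rewrite lee_fin rho0.
    - by rewrite lee_fin q0.
    rewrite integral_mkcond; apply: eq_integral => t _.
    rewrite patchE /F/= indicE; case: ifPn => [|]; rewrite ?(inE, notin_setE)/= in_itv/=.
      move=> /[dup] /andP[t0 tl] H; rewrite mem_set// mulr1.
      by rewrite !ger0_norm ?q0 ?rho0.
    by move=> H; rewrite memNset ?mulr0.
  move=> /negP; rewrite -ltNge => l0; rewrite integral0_eq// => t _.
  by rewrite /F indicE memNset ?mulr0// /A/= => /andP[t0 /(le_lt_trans t0)]; rewrite ltNge (ltW l0).
rewrite [RHS]integral_mkcond; apply: eq_integral => t _.
rewrite [RHS]patchE; case: ifPn => [|]; rewrite ?(inE, notin_setE)/= in_itv/= andbT.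
  move=> t0; rewrite -ge0_integralZl//; last 3 first.
  - exact/measurable_EFinP/measurable_funTS.
  - by move=> l; rewrite /= in_itv/= andbT => tl; rewrite lee_fin q0// (le_trans t0 (ltW tl)).
  - by rewrite lee_fin rho0.
  rewrite [RHS]integral_mkcond; apply: eq_integral => l _.
  rewrite patchE /F/= indicE; case: ifPn => [|]; rewrite ?(inE, notin_setE)/= in_itv/= andbT.
    move=> tl; have H : A (l, t) by apply/andP.
    rewrite mem_set// mulr1 mulrC -EFinM.
    by rewrite !ger0_norm ?q0 ?rho0// (le_trans t0 (ltW tl)).
  by move=> /negP tl; rewrite memNset ?mulr0// /A/= t0 (negbTE tl).
move=> /negP t0; rewrite integral0_eq// => l _.
by rewrite /F indicE memNset ?mulr0// /A/= (negbTE t0).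
Qed.

End layer_cake.

(** * Spectral measures and their tails *)

Section spectral_measure_theory.
Context d (X : measurableType d) (R : realType).
Variable mu : {measure set X -> \bar R}.
Variable E : resolution_of_identity mu.
Implicit Types (f g h k u : L2 mu) (l m : R).

HB.instance Definition _ f := SigmaFiniteMeasure.on (spectral_measure E f).

Lemma spectral_measure_oc f l m : l <= m ->
  spectral_measure E f `]l, m] = (spectral_cdf E f m - spectral_cdf E f l)%:E.
Proof.
move=> lm; rewrite /spectral_measure /lebesgue_stieltjes_measure /measure_extension/=.
by rewrite measurable_mu_extE/= ?wlength_itv_bnd//; exact: is_ocitv.
Qed.

Lemma spectral_cdf_neg f l : l < 0 -> spectral_cdf E f l = 0.
Proof.
move=> l0; rewrite /spectral_cdf innerC (eq_ae_inner f (res_neg E f l0)).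
by rewrite /inner; under eq_Rintegral do rewrite mulr0; rewrite Rintegral_cst// mul0r.
Qed.

Lemma cvg_spectral_cdf f : spectral_cdf E f l @[l --> +oo] --> inner mu f f.
Proof.
apply/subr_cvg0; apply/norm_cvg0P.
have cvg0 : pnorm mu 2%:E (E l f - f) * pnorm mu 2%:E f @[l --> +oo] --> (0 : R).
  rewrite -(mul0r (pnorm mu 2%:E f)); apply: cvgMr_tmp.
  exact: res_total.
apply: (squeeze_cvgr _ (cvg_cst 0) cvg0).
apply/nearW => m; rewrite normr_ge0 /=.
by rewrite /spectral_cdf -innerBl; exact: inner_CauchySchwarz.
Qed.

Lemma spectral_measure_tail f l :
  spectral_measure E f `]l, +oo[ = (inner mu f f - spectral_cdf E f l)%:E.
Proof.
have Fin : spectral_measure E f `]l, l + n%:R] @[n --> \oo] --> spectral_measure E f `]l, +oo[.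
  rewrite (_ : `]l, +oo[%classic = \bigcup_n `]l, l + n%:R]%classic).
    apply: nondecreasing_cvg_mu => //.
      exact: bigcup_measurable.
    move=> m n mn; apply/subsetPset/subset_itvl.
    by rewrite bnd_simp lerD2l ler_nat.
  rewrite eqEsubset; split => [x|x [n _]]; rewrite /= !in_itv/=; last by case/andP=> ->.
  rewrite andbT => lx; exists (Num.bound (x - l)) => //=; rewrite in_itv/= lx/=.
  by rewrite -lerBlDl ltW// archi_boundP// subr_ge0 ltW.
have Ge : spectral_measure E f `]l, l + n%:R] @[n --> \oo] -->
    (inner mu f f - spectral_cdf E f l)%:E.
  under eq_fun do rewrite spectral_measure_oc ?lerDl//.
  apply/cvg_EFin; first exact: nearW.
  apply: cvgB; last exact: cvg_cst.
  apply: (@cvg_comp _ _ _ (fun n : nat => l + n%:R) (spectral_cdf E f)); last exact: cvg_spectral_cdf.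
  by apply/cvgryPge => A; near=> n; rewrite addrC -lerBlDr; near: n; exact: nbhs_infty_ger.
by have := cvg_unique _ Fin Ge; apply.
Unshelve. all: by end_near. Qed.

(** There is no mass on the negative half-line, so that [0, +oo[ is reached as the
    decreasing intersection of the intervals ]-1/n, +oo[. *)
Lemma spectral_measure_ge0 f : spectral_measure E f `[0, +oo[ = (inner mu f f)%:E.
Proof.
have Fin : spectral_measure E f `]- n.+1%:R^-1, +oo[ @[n --> \oo] --> spectral_measure E f `[0, +oo[.
  rewrite (_ : `[0, +oo[%classic = \bigcap_n `]- (n.+1%:R^-1 : R), +oo[%classic).
    apply: nonincreasing_cvg_mu => //.
    - by rewrite [X in (X < _)%E]spectral_measure_tail ltry.
    - exact: bigcap_measurable.
    - move=> m n mn; apply/subsetPset/subset_itvr.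
      by rewrite bnd_simp lerN2 lef_pV2 ?posrE// ler_nat.
  rewrite eqEsubset; split => [x|x].
    by rewrite /= in_itv/= andbT => x0 n _ /=; rewrite in_itv/= andbT (lt_le_trans _ x0)// oppr_lt0.
  move=> H; rewrite /= in_itv/= andbT leNgt; apply/negP => x0.
  have := H (Num.bound (- x)^-1) I; rewrite /= in_itv/= andbT ltrNl; apply/negP.
  rewrite -leNgt -[leRHS]invrK lef_pV2 ?posrE ?invr_gt0 ?oppr_gt0//.
  apply: ltW; apply: lt_trans (_ : (Num.bound (- x)^-1)%:R < _); last by rewrite ltr_nat.
  by rewrite archi_boundP// invr_ge0 oppr_ge0 ltW.
have Ge : spectral_measure E f `]- n.+1%:R^-1, +oo[ @[n --> \oo] --> (inner mu f f)%:E.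
  under eq_fun do rewrite spectral_measure_tail spectral_cdf_neg ?oppr_lt0// subr0.
  exact: cvg_cst.
by have := cvg_unique _ Fin Ge; apply.
Qed.

End spectral_measure_theory.

(** * Primitives on the half-line *)

Section ftc_halfline.
Context (R : realType).
Local Notation leb := (@lebesgue_measure R).

Lemma integral_is_derive (F f : R -> R) (l : R) : continuous f -> F 0 = 0 ->
  (forall t : R, 0 <= t -> is_derive t 1 F (f t)) -> 0 <= l ->
  (\int[leb]_(t in `[0%R, l[) (f t)%:E = (F l)%:E)%E.
Proof.
move=> cf F0 dF; rewrite le_eqVlt => /predU1P[<-|l0].
  by rewrite set_itvco0 integral_set0 F0.
have cF (t : R) : 0 <= t -> F x @[x --> t] --> F t.
  move=> t0; have := dF t t0 => -[/derivable1_diffP/differentiable_continuous + _].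
  exact.
rewrite integral_itv_bndo_bndc; last first.
  by apply/measurable_EFinP/measurable_funTS; exact: continuous_measurable_fun.
rewrite (continuous_FTC2 l0 (F := F))//.
- by rewrite F0 sube0.
- exact: continuous_subspaceT.
- split.
  + by move=> t; rewrite in_itv/= => /andP[/ltW t0 _]; have [] := dF t t0.
  + by apply: cvg_at_right_filter; exact: cF.
  + by apply: cvg_at_left_filter; apply: cF; exact: ltW.
- move=> t; rewrite in_itv/= => /andP[/ltW t0 _].
  have dFt := dF t t0.
  by rewrite derive1E derive_val.
Qed.

End ftc_halfline.

(** * Integrals of symbols over spectral tails *)

Section resolution_forms.
Context d (X : measurableType d) (R : realType).
Variable mu : {measure set X -> \bar R}.
Variable E : resolution_of_identity mu.
Implicit Types (f g h k u v : L2 mu) (l m t : R) (q : R -> R).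
Local Notation leb := (@lebesgue_measure R).

(** The quadratic form of [1 - E_m]; it is the mass that the spectral measure of
    [v] gives to ]m, +oo[. *)
Definition tail_form v m := inner mu v v - spectral_cdf E v m.

Lemma tail_form_polar f k m : tail_form (f + k) m - tail_form (f - k) m =
  4 * (inner mu f k - inner mu (E m f) k).
Proof.
rewrite /tail_form /spectral_cdf.
have s (x y : L2 mu) : inner mu (E m x) y = inner mu x (E m y) by exact: res_symmetric.
rewrite !s !innerE -!s !innerE (innerC k f) (s k f) (innerC k (E m f)); lra.
Qed.

Lemma tail_form_parallelogram f k m : tail_form (f + k) m + tail_form (f - k) m =
  2 * tail_form f m + 2 * tail_form k m.
Proof.
rewrite /tail_form /spectral_cdf.
have s (x y : L2 mu) : inner mu (E m x) y = inner mu x (E m y) by exact: res_symmetric.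
rewrite !s !innerE -!s !innerE; lra.
Qed.

(** The projections [1 - E_l] form a chain: the product of two of them is the one
    with the larger index. *)
Lemma inner_tails f k l m : inner mu (f - E l f) (k - E m k) =
  inner mu f k - inner mu (E (Num.max l m) f) k.
Proof.
rewrite !innerE -(res_symmetric E m (E l f)) -(res_symmetric E m f k).
rewrite (innerC (E m (E l f))) (eq_ae_inner _ (res_min E m l f)) (innerC k).
by case: (leP l m) => lm; ring.
Qed.

Lemma cdf_ge0 f m : 0 <= spectral_cdf E f m.
Proof. by rewrite -(minxx m) -inner_res inner_ge0. Qed.

Lemma tail_form_ge0 f m : 0 <= tail_form f m.
Proof.
have := inner_tails f f m m; rewrite maxxx => {}E'.
by rewrite /tail_form /spectral_cdf -E' inner_ge0.
Qed.

Lemma tail_form_le f m : tail_form f m <= inner mu f f.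
Proof. by rewrite /tail_form lerBlDr lerDl cdf_ge0. Qed.

Lemma tail_form_ni f : {homo tail_form f : l m /~ l <= m}.
Proof. by move=> l m lm; rewrite /tail_form lerD2l lerN2 spectral_cdf_nd. Qed.

(** The quadratic form of [q (A) (1 - E_m)].  A negative [m] gives the form of
    [q (A)] itself, which is how the results on tails are specialized below. *)
Definition tail_int v q m : R :=
  \int[spectral_measure E v]_(l in `[0, +oo[) (q l * \1_`]m, +oo[ l).

Lemma tail_int_integrable v q C m : measurable_fun setT q ->
  (forall l, 0 <= q l <= C) ->
  (spectral_measure E v).-integrable `[0, +oo[ (fun l => (q l * \1_`]m, +oo[ l)%:E).
Proof.
move=> mq qC.
apply: (@le_integrable _ _ _ _ _ _ _ (fun=> C%:E)) => //.
- apply/measurable_EFinP/measurable_funTS; apply: measurable_funM => //.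
- move=> l _; rewrite /= lee_fin normrM (le_trans _ (ler_norm _))//.
  have /andP[q0 qC'] := qC l; rewrite ger0_norm//.
  rewrite -[leRHS]mulr1 ler_pM// indicE; case: (_ \in _); rewrite ?normr1// normr0//.
- apply/integrableP; split => //.
  rewrite integral_cst// [X in (_ * X)%E]spectral_measure_ge0; exact: ltry.
Qed.

Lemma EFin_tail_int v q C m : measurable_fun setT q -> (forall l, 0 <= q l <= C) ->
  (tail_int v q m)%:E =
  (\int[spectral_measure E v]_(l in `[0%R, +oo[) (q l * \1_`]m, +oo[ l)%:E)%E.
Proof.
move=> mq qC; rewrite /tail_int /Rintegral fineK//.
exact: integrable_fin_num (tail_int_integrable v m mq qC).
Qed.

Lemma tail_int_ni v q C : measurable_fun setT q -> (forall l, 0 <= q l <= C) ->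
  {homo tail_int v q : l m /~ l <= m}.
Proof.
move=> mq qC l m lm; apply: le_Rintegral => //.
- exact: tail_int_integrable mq qC.
- exact: tail_int_integrable mq qC.
- move=> x _; have /andP[q0 _] := qC x; rewrite ler_wpM2l//.
  rewrite !indicE ler_nat !mem_setE !in_itv/= !andbT.
  case: (ltP l x) => // xl; case: (ltP m x) => // mx; by move: (le_lt_trans (le_trans mx lm) xl); rewrite ltxx.
Qed.

Lemma tail_int1 v m : tail_int v (cst 1) m = tail_form v m.
Proof.
have c1 (l : R) : 0 <= (cst 1 : R -> R) l <= 1 by rewrite /= ler01 lexx.
apply: EFin_inj; rewrite (EFin_tail_int _ _ _ c1)//.
under eq_integral do rewrite mul1r.
rewrite integral_indic//.
rewrite /tail_form; case: (ltP m 0) => m0.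
  have -> : `]m, +oo[ `&` `[0, +oo[ = `[(0 : R), +oo[%classic.
    by apply: setIidr => x; rewrite /= !in_itv/= !andbT; exact: lt_le_trans.
  by rewrite spectral_cdf_neg// subr0; exact: spectral_measure_ge0.
have -> : `]m, +oo[ `&` `[0, +oo[ = `]m, +oo[%classic.
  by apply: setIidl => x; rewrite /= !in_itv/= !andbT => /ltW; exact: le_trans.
exact: spectral_measure_tail.
Qed.

Lemma tail_intD v q1 q2 C a b m :
  measurable_fun setT q1 -> (forall l, 0 <= q1 l <= C) ->
  measurable_fun setT q2 -> (forall l, 0 <= q2 l <= C) ->
  tail_int v (fun l => a * q1 l + b * q2 l) m = a * tail_int v q1 m + b * tail_int v q2 m.
Proof.
move=> mq1 qC1 mq2 qC2.
have i1 := tail_int_integrable v m mq1 qC1; have i2 := tail_int_integrable v m mq2 qC2.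
rewrite /tail_int -!RintegralZl// -RintegralD//; last 2 first.
- exact: (integrableZl _ a i1).
- exact: (integrableZl _ b i2).
by apply: eq_Rintegral => l _; ring.
Qed.

Lemma tail_int_tail v q t m : 0 <= t ->
  (\int[spectral_measure E v]_(l in `]t, +oo[) (q l * \1_`]m, +oo[ l)%:E =
   \int[spectral_measure E v]_(l in `[0%R, +oo[) (q l * \1_`](Num.max t m), +oo[ l)%:E)%E.
Proof.
move=> t0; rewrite integral_mkcond [RHS]integral_mkcond; apply: eq_integral => l _.
rewrite !patchE !indicE !mem_setE !in_itv/= !andbT gt_max.
case: (ltP t l) => tl; first by rewrite (le_trans t0 (ltW tl)).
by case: ifP => //; rewrite mulr0.
Qed.

Lemma tail_int_layer v q C (eta rho : R -> R) m :
  measurable_fun setT q -> (forall l, 0 <= q l <= C) ->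
  continuous rho -> (forall t, 0 <= rho t) ->
  eta 0 = 0 -> (forall t : R, 0 <= t -> is_derive t 1 eta (rho t)) ->
  (\int[spectral_measure E v]_(l in `[0%R, +oo[) (q l * \1_`]m, +oo[ l * eta l)%:E =
   \int[leb]_(t in `[0%R, +oo[) (rho t * tail_int v q (Num.max t m))%:E)%E.
Proof.
move=> mq qC crho rho0 eta0 deta.
rewrite (@layer_cake _ _ _ eta rho)//.
- apply: eq_integral => t; rewrite inE/= in_itv/= andbT => t0.
  by rewrite tail_int_tail// -(EFin_tail_int _ _ mq qC).
- by apply: measurable_funM => //.
- exact: continuous_measurable_fun.
- by move=> l _; rewrite mulr_ge0//; have /andP[] := qC l.
- by move=> l l0; exact: integral_is_derive.
Qed.

End resolution_forms.

(** * The symbols of the resolvent and of the Yosida approximation *)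

Section symbols.
Context (R : realType) (sigma : R).
Hypothesis sigma0 : 0 < sigma.
Local Notation leb := (@lebesgue_measure R).

(** The absolute value makes the symbol of [(1 + sigma A)^-1] positive, bounded
    and continuous on the whole line. *)
Definition resolvent_symbol (l : R) : R := (1 + sigma * `|l|)^-1.
(** The symbol of the Yosida approximation [A (1 + sigma A)^-1]. *)
Definition yosida_symbol (l : R) : R := `|l| * resolvent_symbol l.

Lemma resolvent_symbol_den (l : R) : 0 < 1 + sigma * `|l|.
Proof. by rewrite ltr_pwDl// mulr_ge0// ltW. Qed.

Lemma resolvent_symbol_gt0 (l : R) : 0 < resolvent_symbol l. Proof. by rewrite invr_gt0 resolvent_symbol_den. Qed.

Lemma resolvent_symbol_le1 (l : R) : resolvent_symbol l <= 1.
Proof. by rewrite invf_le1 ?resolvent_symbol_den// lerDl mulr_ge0// ltW. Qed.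

Lemma resolvent_yosidaE (l : R) : resolvent_symbol l = 1 - sigma * yosida_symbol l.
Proof. by rewrite /yosida_symbol /resolvent_symbol; field; rewrite gt_eqF// resolvent_symbol_den. Qed.

Lemma yosida_symbol_bound (l : R) : 0 <= yosida_symbol l <= sigma^-1.
Proof.
apply/andP; split; first by rewrite mulr_ge0// ltW// resolvent_symbol_gt0.
rewrite -(ler_pM2l sigma0) divff ?gt_eqF//.
have := resolvent_yosidaE l; have := resolvent_symbol_gt0 l; lra.
Qed.

Lemma continuous_resolvent_symbol : continuous resolvent_symbol.
Proof.
move=> l; apply: cvgV; first by rewrite gt_eqF ?resolvent_symbol_den.
apply: cvgD; first exact: cvg_cst.
by apply: cvgM; [exact: cvg_cst|exact: norm_continuous].
Qed.

Lemma continuous_resolvent_symbolX p : continuous (fun l => resolvent_symbol l ^+ p).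
Proof.
move=> l; apply: (@cvg_comp _ _ _ resolvent_symbol (fun x => x ^+ p)); first exact: continuous_resolvent_symbol.
exact: exprn_continuous.
Qed.

Lemma measurable_resolvent_symbolX p : measurable_fun setT (fun l => resolvent_symbol l ^+ p).
Proof. exact: continuous_measurable_fun (@continuous_resolvent_symbolX p). Qed.

Lemma measurable_resolvent_symbol : measurable_fun setT resolvent_symbol.
Proof. exact: continuous_measurable_fun continuous_resolvent_symbol. Qed.

Lemma measurable_yosida_symbol : measurable_fun setT yosida_symbol.
Proof. by apply: measurable_funM => //; exact: measurable_resolvent_symbol. Qed.

Lemma is_derive_resolvent_symbolX p (t : R) : 0 <= t ->
  is_derive t 1 (fun t => 1 - (1 + sigma * t)^-1 ^+ p) (p%:R * sigma * resolvent_symbol t ^+ p.+1).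
Proof.
move=> t0; have n0 : 1 + sigma * t != 0 by rewrite gt_eqF// ltr_pwDl// mulr_ge0// ltW.
have d1 : is_derive t 1 (fun t : R => 1 + sigma * t) sigma.
  have := is_deriveD (is_derive_cst (1 : R) t 1) (is_deriveZ sigma (is_derive_id t 1)).
  by rewrite add0r [_ *: _]mulr1.
have d2 := is_deriveX p (@is_deriveV _ (fun t : R => 1 + sigma * t) t sigma 1 n0 d1).
have d3 := is_deriveB (is_derive_cst (1 : R) t 1) d2.
rewrite (_ : (fun _ => _) = cst (1 : R) - (fun t : R => (1 + sigma * t)^-1) ^+ p); last first.
  by apply/funext => y; rewrite !fctE.
apply: is_derive_eq d3 _.
rewrite sub0r /resolvent_symbol ger0_norm//.
case: p {d2} => [|p]; first by rewrite !mul0r scale0r oppr0.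
rewrite -exprVn /GRing.scale /=; set y := (1 + sigma * t)^-1.
by rewrite !exprS; ring.
Qed.

End symbols.

(** * Resolvents of an operator with a spectral resolution *)

Section resolvent.
Context d (X : measurableType d) (R : realType).
Variable mu : {measure set X -> \bar R}.
Variable E : resolution_of_identity mu.
Variable sigma : R.
Hypothesis sigma0 : 0 < sigma.
Implicit Types (f g h k u v : L2 mu) (l m t C : R) (q : R -> R).
Local Notation leb := (@lebesgue_measure R).
Local Notation psi := (resolvent_symbol sigma).
Local Notation eta := (yosida_symbol sigma).

Let psi01 p l : 0 <= psi l ^+ p <= 1.
Proof.
by rewrite exprn_ge0 ?exprn_ile1// ?(ltW (resolvent_symbol_gt0 sigma0 l))// resolvent_symbol_le1.
Qed.

Let psi_b l : 0 <= psi l <= 1 := psi01 1 l.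

Let one_b l : 0 <= (cst 1 : R -> R) l <= 1.
Proof. by rewrite /= ler01 lexx. Qed.

Let mD : measurable (`[(0 : R), +oo[%classic : set (g_sigma_algebraType R.-ocitv.-measurable)).
Proof. exact: measurable_itv. Qed.

Let D0 (t : R) : t \in `[(0 : R), +oo[%classic -> 0 <= t.
Proof. by rewrite inE/= in_itv/= andbT. Qed.

(** The Yosida symbol is the primitive of the square of the resolvent symbol.  It
    is written here without absolute value, so as to be differentiable at [0]. *)
Lemma is_derive_yosida t : 0 <= t ->
  is_derive t 1 (fun t => sigma^-1 * (1 - (1 + sigma * t)^-1 ^+ 1)) (psi t ^+ 2).
Proof.
move=> t0; have := is_deriveZ sigma^-1 (is_derive_resolvent_symbolX sigma0 1 t0).
move=> H; apply: is_derive_eq H _.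
by rewrite /GRing.scale /= mul1r mulKf// gt_eqF.
Qed.

Lemma yosida_ge0E l : 0 <= l -> sigma^-1 * (1 - (1 + sigma * l)^-1 ^+ 1) = eta l.
Proof.
move=> l0; have := resolvent_yosidaE sigma0 l.
rewrite /resolvent_symbol ger0_norm// expr1 => ->; rewrite opprB addrC subrK mulKf//.
by rewrite gt_eqF.
Qed.

Lemma yosida_layer v q C m : measurable_fun setT q -> (forall l, 0 <= q l <= C) ->
  (tail_int E v (fun l => q l * eta l) m)%:E =
  (\int[leb]_(t in `[0%R, +oo[) (psi t ^+ 2 * tail_int E v q (Num.max t m))%:E)%E.
Proof.
move=> mq qC; rewrite (@EFin_tail_int _ _ _ _ E _ _ (C * sigma^-1)); first last.
- move=> l; have /andP[e0 e1] := yosida_symbol_bound sigma0 l; have /andP[q0 q1] := qC l.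
  by rewrite mulr_ge0 ?ler_pM.
- apply: measurable_funM => //; exact: measurable_yosida_symbol.
have eta0 : sigma^-1 * (1 - (1 + sigma * 0)^-1 ^+ 1) = 0.
  by rewrite mulr0 addr0 invr1 expr1n subrr mulr0.
rewrite -(tail_int_layer E v m mq qC (continuous_resolvent_symbolX sigma0 (p := 2))
  (fun t => sqr_ge0 (psi t)) eta0 is_derive_yosida).
by apply: eq_integral => l /D0 l0; rewrite yosida_ge0E// mulrAC.
Qed.

Lemma measurable_tail_int v q C m : measurable_fun setT q -> (forall l, 0 <= q l <= C) ->
  measurable_fun setT (fun t => tail_int E v q (Num.max t m)).
Proof.
move=> mq qC; rewrite (_ : (fun t => _) = \- (fun t => - tail_int E v q (Num.max t m))); last first.
  by apply/funext => t /=; rewrite opprK.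
apply: measurableT_comp => //; apply: nondecreasing_measurable => // s t st.
rewrite lerN2; apply: (tail_int_ni E v mq qC).
by rewrite ge_max !le_max st lexx orbT.
Qed.

Lemma yosida_layer_integrable v q C m : measurable_fun setT q -> (forall l, 0 <= q l <= C) ->
  leb.-integrable `[0, +oo[ (fun t => (psi t ^+ 2 * tail_int E v q (Num.max t m))%:E).
Proof.
move=> mq qC; apply/integrableP; split.
  apply/measurable_EFinP/measurable_funTS; apply: measurable_funM.
    exact: measurable_resolvent_symbolX.
  exact: measurable_tail_int mq qC.
under eq_integral.
  move=> t _; rewrite gee0_abs; last first.
    rewrite lee_fin mulr_ge0 ?sqr_ge0// /tail_int Rintegral_ge0// => l _.
    by have /andP[q0 _] := qC l; rewrite mulr_ge0.
  over.
by rewrite -(yosida_layer _ _ mq qC) ltry.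
Qed.

Lemma yosida_layerR v q C m : measurable_fun setT q -> (forall l, 0 <= q l <= C) ->
  tail_int E v (fun l => q l * eta l) m =
  \int[leb]_(t in `[0, +oo[) (psi t ^+ 2 * tail_int E v q (Num.max t m)).
Proof. by move=> mq qC; rewrite /Rintegral -(yosida_layer _ _ mq qC). Qed.

Lemma tail_int1_yosida v m : tail_int E v (fun l => cst 1 l * eta l) m = tail_int E v eta m.
Proof. by congr tail_int; apply/funext => l; rewrite mul1r. Qed.

Lemma yosida_layer1 v m :
  tail_int E v eta m =
  \int[leb]_(t in `[0, +oo[) (psi t ^+ 2 * tail_form E v (Num.max t m)).
Proof.
rewrite -tail_int1_yosida (yosida_layerR _ _ (measurable_cst _) one_b).
by apply: eq_Rintegral => t _; rewrite tail_int1.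
Qed.

Lemma yosida_layer1_integrable v m :
  leb.-integrable `[0, +oo[ (fun t => (psi t ^+ 2 * tail_form E v (Num.max t m))%:E).
Proof.
have := yosida_layer_integrable v m (measurable_cst _) one_b.
by apply: eq_integrable => // t _; rewrite tail_int1.
Qed.

Lemma polar_integrable f k m : leb.-integrable `[0, +oo[
  (fun t => (psi t ^+ 2 * (inner mu f k - inner mu (E (Num.max t m) f) k))%:E).
Proof.
have ip := yosida_layer1_integrable (f + k) m; have im := yosida_layer1_integrable (f - k) m.
have := integrableZl mD 4^-1 (integrableB mD ip im).
by apply: eq_integrable => // t _; rewrite -EFinB -EFinM -mulrBr tail_form_polar; congr EFin; field.
Qed.

(** The Yosida approximation as an average of the projections [1 - E_t] with
    density [psi t ^+ 2]; in this form it is linear in each argument. *)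
Lemma yosida_polar f k m : 4^-1 * (tail_int E (f + k) eta m - tail_int E (f - k) eta m) =
  \int[leb]_(t in `[0, +oo[) (psi t ^+ 2 * (inner mu f k - inner mu (E (Num.max t m) f) k)).
Proof.
have ip := yosida_layer1_integrable (f + k) m; have im := yosida_layer1_integrable (f - k) m.
rewrite !yosida_layer1 -RintegralB// -RintegralZl//; last exact: (integrableB mD ip im).
by apply: eq_Rintegral => t _; rewrite -mulrBr tail_form_polar; field.
Qed.

Lemma integral_resolvent_symbol2 : (\int[leb]_(t in `[0%R, +oo[) (psi t ^+ 2)%:E = sigma^-1%:E)%E.
Proof.
rewrite (@ge0_continuous_FTC2y _ _ (fun t => sigma^-1 * (1 - (1 + sigma * t)^-1 ^+ 1)) _ sigma^-1).
- by rewrite mulr0 addr0 invr1 expr1n subrr mulr0 sube0.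
- by move=> t _; rewrite sqr_ge0.
- apply: continuous_subspaceT; exact: continuous_resolvent_symbolX.
- rewrite -[X in _ --> X]mulr1 -[X in _ * X]subr0; apply: cvgM; first exact: cvg_cst.
  apply: cvgB; first exact: cvg_cst.
  under eq_fun do rewrite expr1.
  apply/cvgrVy.
    by near=> t; rewrite invr_gt0 ltr_pwDl// mulr_ge0 ?ltW.
  rewrite [X in X @ _ --> _](_ : _ = fun t => 1 + sigma * t); last first.
    by apply/funext => t; rewrite /= invrK.
  apply/cvgryPge => A; near=> t.
  have : sigma^-1 * A <= t by near: t; apply: nbhs_pinfty_ge; exact: num_real.
  rewrite ler_pdivrMl//; lra.
- by move=> t /ltW /is_derive_yosida [].
- have [+ _] := is_derive_yosida (lexx 0).
  move=> /derivable1_diffP/differentiable_continuous; exact: cvg_at_right_filter.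
- move=> t; rewrite in_itv/= andbT => /ltW t0.
  by have dt := is_derive_yosida t0; rewrite derive1E derive_val.
Unshelve. all: by end_near. Qed.

(** The vector [h] that plays the role of [A (1 + sigma A)^-1 f] is obtained from
    its inner products by the Riesz representation theorem.  The formula is stated
    for all tails of [h], since these determine its spectral measure. *)
Lemma resolvent_riesz f : exists h, forall m k,
  inner mu (h - E m h) k = 4^-1 * (tail_int E (f + k) eta m - tail_int E (f - k) eta m).
Proof.
pose phi k := \int[leb]_(t in `[0, +oo[) (psi t ^+ 2 * (inner mu f k - inner mu (E (Num.max t (-1)) f) k)).
have [h hE] : exists h, forall k, inner mu h k = phi k.
  apply: (@L2_riesz _ _ _ _ phi (sigma^-1 * pnorm mu 2%:E f)).
  - move=> a g k; have ig := polar_integrable f g (-1); have ik := polar_integrable f k (-1).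
    rewrite /phi -RintegralZl// -RintegralD//; last exact: (integrableZl _ a ig).
    by apply: eq_Rintegral => t _; rewrite !innerE; ring.
  - move=> k; have ik := polar_integrable f k (-1).
    apply: le_trans (le_normr_Rintegral _ ik) _ => //.
    rewrite -lee_fin /Rintegral fineK; last first.
      exact/integrable_fin_num/integrable_norm.
    apply: (@le_trans _ _ (\int[leb]_(t in `[0%R, +oo[)
        ((pnorm mu 2%:E f * pnorm mu 2%:E k)%:E * (psi t ^+ 2)%:E))%E).
      apply: ge0_le_integral => //.
      + by apply/measurable_EFinP; apply: measurableT_comp => //; apply/measurable_EFinP; case/integrableP: ik.
      + by apply/measurable_EFinP/measurable_funTS; apply: measurable_funM => //; exact: measurable_resolvent_symbolX.
      + move=> t _; rewrite -EFinM lee_fin normrM ger0_norm ?sqr_ge0// mulrC ler_wpM2r ?sqr_ge0//.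
        rewrite -innerBl; apply: le_trans (inner_CauchySchwarz _ _) _.
        rewrite ler_wpM2r ?pnorm_ge0// !pnorm2E ler_wsqrtr//.
        by rewrite inner_tails maxxx; exact: tail_form_le.
    have m2 : measurable_fun (`[(0 : R), +oo[%classic) (fun t => (psi t ^+ 2)%:E).
      by apply/measurable_EFinP/measurable_funTS; exact: measurable_resolvent_symbolX.
    have c0 : (0 <= (pnorm mu 2%:E f * pnorm mu 2%:E k)%:E)%E.
      by rewrite lee_fin mulr_ge0 ?pnorm_ge0.
    rewrite ge0_integralZl//; last by move=> t _; rewrite lee_fin sqr_ge0.
    by rewrite [X in (_ * X <= _)%E]integral_resolvent_symbol2 -EFinM lee_fin mulrC mulrA.
exists h => m k; rewrite yosida_polar innerBl res_symmetric -innerBr hE.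
apply: eq_Rintegral => t /D0 t0; rewrite -innerBl inner_tails.
by have -> : Num.max t (-1) = t by apply/max_idPl; lra.
Qed.

Lemma yosida_polar_diag f m :
  4^-1 * (tail_int E (f + f) eta m - tail_int E (f - f) eta m) = tail_int E f eta m.
Proof. by rewrite yosida_polar yosida_layer1. Qed.

Lemma tail_int_resolvent_symbol v m :
  tail_int E v psi m = tail_form E v m - sigma * tail_int E v eta m.
Proof.
have b1 l : 0 <= (cst 1 : R -> R) l <= 1 + sigma^-1.
  by rewrite /= ler01 lerDl invr_ge0 ltW.
have b2 l : 0 <= eta l <= 1 + sigma^-1.
  by have /andP[-> /le_trans->] := yosida_symbol_bound sigma0 l; rewrite ?lerDr.
rewrite -tail_int1 -[X in X - _]mul1r -mulNr.
rewrite -(tail_intD E v 1 (- sigma) m (measurable_cst _) b1 (measurable_yosida_symbol sigma0) b2).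
by congr tail_int; apply/funext => l; rewrite (resolvent_yosidaE sigma0) mul1r mulNr.
Qed.

Let max1 t : 0 <= t -> Num.max t (-1) = t.
Proof. by move=> t0; apply/max_idPl; lra. Qed.

Let ind1 l : 0 <= l -> \1_(`](-1 : R), +oo[%classic : set R) l = 1 :> R.
Proof. by move=> l0; rewrite indicE mem_set//= in_itv/= andbT; lra. Qed.

Let EFin_tail_int_neg v q C : measurable_fun setT q -> (forall l, 0 <= q l <= C) ->
  (\int[spectral_measure E v]_(l in `[0%R, +oo[) (q l)%:E = (tail_int E v q (-1))%:E)%E.
Proof.
move=> mq qC; rewrite (EFin_tail_int E v (-1) mq qC).
by apply: eq_integral => l /D0 l0; rewrite ind1// mulr1.
Qed.

Let iddom v := (\int[spectral_measure E v]_(l in `[0%R, +oo[) l%:E)%E.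

Let iddomE v : iddom v = (\int[leb]_(t in `[0%R, +oo[) (tail_form E v t)%:E)%E.
Proof.
have cv1 : continuous (cst 1 : R -> R) by move=> x; exact: cvg_cst.
have L := tail_int_layer E v (-1) (measurable_cst _) one_b cv1 (fun=> ler01)
  (erefl : id 0 = 0 :> R) (fun t _ => is_derive_id t 1).
transitivity (\int[spectral_measure E v]_(l in `[0%R, +oo[) (cst 1 l * \1_`](-1), +oo[ l * l)%:E)%E.
  by clear L; apply: eq_integral => l /D0 l0; rewrite ind1// !mul1r.
rewrite L; clear L; apply: eq_integral => t /D0 t0.
by rewrite tail_int1 max1// mul1r.
Qed.

Let measurable_tail_form v : measurable_fun setT (tail_form E v).
Proof.
rewrite (_ : tail_form E v = \- (fun t => - tail_form E v t)); last first.
  by apply/funext => t /=; rewrite opprK.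
apply: measurableT_comp => //; apply: nondecreasing_measurable => // s t st.
by rewrite lerN2; exact: tail_form_ni.
Qed.

Let tail_integrable v : spectral_dom E (fun l => l) v ->
  leb.-integrable `[0, +oo[ (fun t => (tail_form E v t)%:E).
Proof.
move=> vdom; apply/integrableP; split.
  by apply/measurable_EFinP/measurable_funTS; exact: measurable_tail_form.
under eq_integral do rewrite gee0_abs ?lee_fin ?tail_form_ge0//.
rewrite -iddomE /iddom.
apply: (@le_lt_trans _ _ (\int[spectral_measure E v]_(l in `[0%R, +oo[) (1%:E + (`|l| ^+ 2)%:E))%E).
  apply: ge0_le_integral => //.
  - by move=> l; rewrite /= in_itv/= andbT lee_fin.
  - apply: emeasurable_funD => //; apply/measurable_EFinP.
    by apply: measurable_funX; exact: normr_measurable.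
  - move=> l _; rewrite -EFinD lee_fin real_normK ?num_real//.
    by have := sqr_ge0 (l - 1); rewrite sqrrB; have := sqr_ge0 l; lra.
rewrite ge0_integralD//; last first.
  by apply/measurable_EFinP; apply: measurable_funX; exact: normr_measurable.
apply: lte_add_pinfty; last exact: vdom.
by rewrite integral_cst// [X in (_ * X)%E]spectral_measure_ge0 ltry.
Qed.

Let resolvent_symbol_layer v : leb.-integrable `[0, +oo[ (fun t => (tail_int E v psi t)%:E) /\
  \int[leb]_(t in `[0, +oo[) tail_int E v psi t = tail_int E v eta (-1).
Proof.
have cv1 : continuous (cst 1 : R -> R) by move=> x; exact: cvg_cst.
have L := tail_int_layer E v (-1) (measurable_resolvent_symbol sigma0) psi_b cv1 (fun=> ler01)
  (erefl : id 0 = 0 :> R) (fun t _ => is_derive_id t 1).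
have L' : (\int[leb]_(t in `[0%R, +oo[) (tail_int E v psi t)%:E = (tail_int E v eta (-1))%:E)%E.
  rewrite (EFin_tail_int E v (-1) (measurable_yosida_symbol sigma0) (yosida_symbol_bound sigma0)).
  transitivity (\int[leb]_(t in `[0%R, +oo[) (cst 1 t * tail_int E v psi (Num.max t (-1)))%:E)%E.
    by clear L; apply: eq_integral => t /D0 t0; rewrite max1// mul1r.
  rewrite -L; clear L; apply: eq_integral => l /D0 l0.
  by rewrite /yosida_symbol ger0_norm// mulrAC [l * _]mulrC.
clear L; split; last by rewrite /Rintegral L'.
apply/integrableP; split.
  clear L'.
  apply/measurable_EFinP/measurable_funTS.
  rewrite (_ : tail_int E v psi = \- (fun t => - tail_int E v psi t)); last first.
    by apply/funext => t /=; rewrite opprK.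
  apply: (measurableT_comp (f := @GRing.opp R)) => //; apply: nondecreasing_measurable => // s t st.
  by rewrite lerN2; exact: (tail_int_ni E v (measurable_resolvent_symbol sigma0) psi_b).
under eq_integral.
  move=> t _; rewrite gee0_abs; last first.
    clear L'; rewrite lee_fin /tail_int Rintegral_ge0// => l _.
    by have /andP[q0 _] := psi_b l; rewrite mulr_ge0.
  over.
by rewrite L' ltry.
Qed.

Section resolvent_data.
Variables f h : L2 mu.
Hypothesis hE : forall m k,
  inner mu (h - E m h) k = 4^-1 * (tail_int E (f + k) eta m - tail_int E (f - k) eta m).
Let u := f - sigma *: h.

(* evaluating at -1 turns statements on tails into statements on whole vectors *)
Let Eneg (v k : L2 mu) : inner mu (v - E (-1) v) k = inner mu v k.
Proof.
have n1 : (-1 : R) < 0 by lra.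
rewrite innerBl (innerC (E _ _)) (eq_ae_inner k (res_neg E v n1)).
have -> : inner mu k (cst 0) = 0.
  by rewrite /inner; under eq_Rintegral do rewrite mulr0; rewrite Rintegral_cst// mul0r.
by rewrite subr0.
Qed.

Let hf m : inner mu (h - E m h) f = tail_int E f eta m.
Proof. by rewrite hE yosida_polar_diag. Qed.

Let hh m : inner mu (h - E m h) h = tail_int E f (fun l => eta l * eta l) m.
Proof.
rewrite hE yosida_polar (yosida_layerR _ _ (measurable_yosida_symbol sigma0) (yosida_symbol_bound sigma0)).
apply: eq_Rintegral => t _; congr (_ * _).
by rewrite -hf innerBl res_symmetric (innerC f h) [inner mu f (E _ _)]innerC.
Qed.

(** The spectral measure of [u] has density [psi ^+ 2] with respect to that of
    [f]: expand the square in [u = f - sigma h] and use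
    [psi = 1 - sigma eta]. *)
Lemma resolvent_tail m : tail_form E u m = tail_int E f (fun l => psi l ^+ 2) m.
Proof.
have b (q : R -> R) c : 0 <= c -> c <= 1 + sigma^-1 + sigma^-1 * sigma^-1 ->
    (forall l, 0 <= q l <= c) ->
    forall l, 0 <= q l <= 1 + sigma^-1 + sigma^-1 * sigma^-1.
  by move=> _ cC qc l; have /andP[-> /le_trans->] := qc l.
have s0 : 0 < sigma^-1 by rewrite invr_gt0.
have ss0 : 0 < sigma^-1 * sigma^-1 by rewrite mulr_gt0.
have b1 := b (cst 1) 1 ltac:(lra) ltac:(lra) one_b.
have b2 := b eta sigma^-1 ltac:(lra) ltac:(lra) (yosida_symbol_bound sigma0).
have b3 : forall l, 0 <= eta l * eta l <= 1 + sigma^-1 + sigma^-1 * sigma^-1.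
  apply: (b _ (sigma^-1 * sigma^-1)); [lra|lra|move=> l].
  by have /andP[e0 e1] := yosida_symbol_bound sigma0 l; rewrite mulr_ge0 ?ler_pM.
have b4 := b _ 1 ltac:(lra) ltac:(lra) (psi01 2).
have me := measurable_yosida_symbol sigma0.
have mee : measurable_fun setT (fun l => eta l * eta l) by exact: measurable_funM.
(* psi^2 + 2 sigma eta = 1 + sigma^2 eta^2 *)
have key : tail_int E f (fun l => psi l ^+ 2) m + 2 * sigma * tail_int E f eta m =
    tail_form E f m + sigma ^+ 2 * tail_int E f (fun l => eta l * eta l) m.
  rewrite -tail_int1 -[X in X + _ = _]mul1r -[X in _ = X + _]mul1r.
  rewrite -(tail_intD E f 1 (2 * sigma) m (measurable_resolvent_symbolX sigma0 2) b4 me b2).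
  rewrite -(tail_intD E f 1 (sigma ^+ 2) m (measurable_cst _) b1 mee b3).
  by congr tail_int; apply/funext => l; rewrite (resolvent_yosidaE sigma0) /=; ring.
have -> : tail_form E u m = tail_form E f m - 2 * sigma * inner mu (h - E m h) f
    + sigma ^+ 2 * inner mu (h - E m h) h.
  rewrite /tail_form /spectral_cdf /u.
  have s (x y : L2 mu) : inner mu (E m x) y = inner mu x (E m y) by exact: res_symmetric.
  rewrite !s !innerE -!s !innerE (innerC f h) (s f h) (innerC f); ring.
rewrite hf hh; lra.
Qed.

(** Equality of the tails of the measures of [u] and [psi ^+ 2 * f] gives equality
    of the integrals of all increasing symbols, by the layer-cake formula. *)
Lemma resolvent_transfer (chi rho : R -> R) : continuous rho -> (forall t, 0 <= rho t) ->
  chi 0 = 0 -> (forall t : R, 0 <= t -> is_derive t 1 chi (rho t)) ->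
  (\int[spectral_measure E u]_(l in `[0%R, +oo[) (chi l)%:E =
   \int[spectral_measure E f]_(l in `[0%R, +oo[) (psi l ^+ 2 * chi l)%:E)%E.
Proof.
move=> crho rho0 chi0 dchi.
have ind (q : R -> R) v : (\int[spectral_measure E v]_(l in `[0%R, +oo[) (q l * chi l)%:E =
    \int[spectral_measure E v]_(l in `[0%R, +oo[) (q l * \1_`](-1), +oo[ l * chi l)%:E)%E.
  apply: eq_integral => l /D0 l0; rewrite indicE mem_set ?mulr1//=.
  by rewrite in_itv/= andbT; lra.
transitivity (\int[spectral_measure E u]_(l in `[0%R, +oo[) (cst 1 l * chi l)%:E)%E.
  by apply: eq_integral => l _; rewrite mul1r.
have Lu := tail_int_layer E u (-1) (measurable_cst _) one_b crho rho0 chi0 dchi.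
have Lf := tail_int_layer E f (-1) (measurable_resolvent_symbolX sigma0 2) (psi01 2) crho rho0 chi0 dchi.
apply: etrans (etrans (ind (cst 1) u) Lu) _.
apply: etrans _ (esym (etrans (ind (fun l => psi l ^+ 2) f) Lf)).
by apply: eq_integral => t _; rewrite tail_int1 resolvent_tail.
Qed.

(** Powers of [psi] decrease: apply [resolvent_transfer] to [1 - psi ^+ p] and
    subtract from the total masses. *)
Lemma resolvent_symbolX_transfer p :
  (\int[spectral_measure E u]_(l in `[0%R, +oo[) (psi l ^+ p)%:E =
   \int[spectral_measure E f]_(l in `[0%R, +oo[) (psi l ^+ p.+2)%:E)%E.
Proof.
pose c l := 1 - psi l ^+ p.
have cb l : 0 <= c l <= 1.
  have /andP[p0 p1] := psi01 p l; rewrite /c; lra.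
have mc : measurable_fun setT c by apply: measurable_funB => //; exact: measurable_resolvent_symbolX.
have mp2c : measurable_fun setT (fun l => psi l ^+ 2 * c l).
  by apply: measurable_funM => //; exact: measurable_resolvent_symbolX.
have p2cb l : 0 <= psi l ^+ 2 * c l <= 1.
  have /andP[p0 p1] := psi01 2 l; have /andP[c0 c1] := cb l.
  by rewrite mulr_ge0//= mulr_ile1.
have T : tail_int E u c (-1) = tail_int E f (fun l => psi l ^+ 2 * c l) (-1).
  apply: EFin_inj.
  apply: etrans (esym (EFin_tail_int_neg u mc cb)) _.
  apply: etrans _ (EFin_tail_int_neg f mp2c p2cb).
  have cE l : 0 <= l -> 1 - (1 + sigma * l)^-1 ^+ p = c l.
    by move=> l0; rewrite /c /resolvent_symbol ger0_norm.
  transitivity (\int[spectral_measure E u]_(l in `[0%R, +oo[) (1 - (1 + sigma * l)^-1 ^+ p)%:E)%E.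
    by apply: eq_integral => l /D0 l0; rewrite cE.
  have crho : continuous (fun t => p%:R * sigma * psi t ^+ p.+1).
    by move=> t; apply: cvgM; [exact: cvg_cst|exact: (continuous_resolvent_symbolX sigma0)].
  have rho0 t : 0 <= p%:R * sigma * psi t ^+ p.+1.
    by rewrite !mulr_ge0 ?(ltW sigma0)//; case/andP: (psi01 p.+1 t).
  have chi0 : 1 - (1 + sigma * 0)^-1 ^+ p = 0.
    by rewrite mulr0 addr0 invr1 expr1n subrr.
  apply: etrans (resolvent_transfer (chi := fun l => 1 - (1 + sigma * l)^-1 ^+ p) crho rho0 chi0 (fun t => @is_derive_resolvent_symbolX _ _ sigma0 p t)) _.
  by apply: eq_integral => l /D0 l0; rewrite cE.
have mp := measurable_resolvent_symbolX sigma0.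
have Du : tail_form E u (-1) = tail_int E u (fun l => psi l ^+ p) (-1) + tail_int E u c (-1).
  rewrite -[X in _ = X + _]mul1r -[X in _ = _ + X]mul1r.
  rewrite -(tail_intD E u 1 1 (-1) (mp p) (psi01 p) mc cb) -tail_int1.
  by congr tail_int; apply/funext => l; rewrite /c /=; ring.
have Df : tail_int E f (fun l => psi l ^+ 2) (-1) = tail_int E f (fun l => psi l ^+ p.+2) (-1)
    + tail_int E f (fun l => psi l ^+ 2 * c l) (-1).
  rewrite -[X in _ = X + _]mul1r -[X in _ = _ + X]mul1r.
  rewrite -(tail_intD E f 1 1 (-1) (mp p.+2) (psi01 p.+2) mp2c p2cb).
  by congr tail_int; apply/funext => l; rewrite /c /= !exprS; ring.
apply: etrans (EFin_tail_int_neg u (mp p) (psi01 p)) _.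
apply: etrans _ (esym (EFin_tail_int_neg f (mp p.+2) (psi01 p.+2))).
apply: (congr1 EFin); apply: (@addIr _ (tail_int E u c (-1))).
apply: etrans (esym Du) (etrans (resolvent_tail (-1)) (etrans Df _)).
exact: (congr1 _ (esym T)).
Qed.

Lemma resolvent_dom : spectral_dom E (fun l => l) u.
Proof.
rewrite /spectral_dom.
have -> : (\int[spectral_measure E u]_(l in `[0%R, +oo[) (`|l| ^+ 2)%:E =
    \int[spectral_measure E f]_(l in `[0%R, +oo[) (psi l ^+ 2 * l ^+ 2)%:E)%E.
  have crho : continuous (fun l : R => 2 * `|l|).
    by move=> l; apply: cvgM; [exact: cvg_cst|exact: norm_continuous].
  have rho0 (t : R) : 0 <= 2 * `|t| by rewrite mulr_ge0.
  have chi0 : (0 : R) ^+ 2 = 0 by rewrite expr0n.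
  have dchi (t : R) : 0 <= t -> is_derive t 1 (fun l : R => l ^+ 2) (2 * `|t|).
    move=> t0; have H := is_deriveX 2 (is_derive_id t 1).
    by apply: is_derive_eq H _; rewrite ger0_norm// /GRing.scale /= mulr1.
  apply: etrans _ (resolvent_transfer (chi := fun l => l ^+ 2) crho rho0 chi0 dchi).
  by apply: eq_integral => l _; rewrite real_normK ?num_real.
apply: (@le_lt_trans _ _ (\int[spectral_measure E f]_(l in `[0%R, +oo[) (sigma^-1 ^+ 2)%:E)%E).
  apply: ge0_le_integral => //.
  - by move=> l _; rewrite lee_fin mulr_ge0 ?sqr_ge0.
  - apply/measurable_EFinP/measurable_funTS; apply: measurable_funM.
      exact: measurable_resolvent_symbolX.
    exact: measurable_funX.
  - move=> l _; rewrite lee_fin mulrC -(real_normK (num_real l)) -exprMn.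
    have /andP[e0 e1] := yosida_symbol_bound sigma0 l.
    by rewrite lerXn2r ?nnegrE ?invr_ge0 ?(ltW sigma0).
by rewrite integral_cst// [X in (_ * X)%E]spectral_measure_ge0 ltry.
Qed.

(** Polarized form of the identity [u = psi (A) f] on tails. *)
Lemma resolvent_polar k t :
  tail_int E (f + k) psi t - tail_int E (f - k) psi t =
  tail_form E (u + k) t - tail_form E (u - k) t.
Proof.
have arith (A B C D a b p q r : R) : A - B = 4 * p -> C - D = 4 * q ->
    r = 4^-1 * (a - b) -> q = p - sigma * r -> (A - sigma * a) - (B - sigma * b) = C - D.
  move=> AB -> H ->; have ab : a - b = 4 * r by rewrite H; field.
  by rewrite mulrBr -AB mulrCA -ab; ring.
rewrite (tail_int_resolvent_symbol (f + k)) (tail_int_resolvent_symbol (f - k)).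
apply: arith (tail_form_polar E f k t) (tail_form_polar E u k t) (hE t k) _.
have s (x y : L2 mu) : inner mu (E t x) y = inner mu x (E t y) by exact: res_symmetric.
rewrite /u !innerE s (s f) (s h) !innerE; ring.
Qed.

(** [u] belongs to the domain of [A] and [A u = h], that is, [u + sigma A u = f].
    Integrating [resolvent_polar] over all tails replaces [1 - E_t] by [A] on the
    side of [u], and [psi] by [eta], its product with the identity, on the side of
    [f]. *)
Lemma resolvent_spectral_integral : spectral_integral E (fun l => l) u h.
Proof.
refine (conj resolvent_dom _) => k kdom.
have iu := tail_integrable resolvent_dom; have ik := tail_integrable kdom.
have idom v : v = u + k \/ v = u - k -> leb.-integrable `[0, +oo[ (fun t => (tail_form E v t)%:E).
  move=> vE; have i2 := integrableZl mD 2 (integrableD mD iu ik).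
  apply: (le_integrable mD _ _ i2).
    by apply/measurable_EFinP/measurable_funTS; exact: measurable_tail_form.
  move=> t _; have q0 : 0 <= 2 * (tail_form E u t + tail_form E k t).
    by apply: mulr_ge0 => //; apply: addr_ge0; exact: tail_form_ge0.
  rewrite -EFinD -EFinM !abse_EFin lee_fin (ger0_norm q0) (ger0_norm (tail_form_ge0 E v t)).
  have := tail_form_parallelogram E u k t.
  have := tail_form_ge0 E (u + k) t; have := tail_form_ge0 E (u - k) t.
  by case: vE => ->; lra.
have ip := idom _ (or_introl erefl); have im := idom _ (or_intror erefl).
have [jp jpE] := resolvent_symbol_layer (f + k); have [jm jmE] := resolvent_symbol_layer (f - k).
have RE v : \int[spectral_measure E v]_(l in `[0, +oo[) l = \int[leb]_(t in `[0, +oo[) tail_form E v t.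
  exact: (congr1 fine (iddomE v)).
apply: etrans (etrans (esym (Eneg h k)) (hE (-1) k)) _.
apply: (congr1 ( *%R 4^-1)).
apply: etrans (f_equal2 (fun a b => a - b) (esym jpE) (esym jmE)) _.
apply: etrans _ (esym (f_equal2 (fun a b => a - b) (RE (u + k)) (RE (u - k)))).
apply: etrans (esym (RintegralB mD jp jm)) _.
apply: etrans _ (RintegralB mD ip im).
clear jp jpE jm jmE RE ip im iu ik idom.
apply: eq_Rintegral => t _.
exact: resolvent_polar.
Qed.

End resolvent_data.

End resolvent.

(** * Bernstein functions as mixtures of splines *)

Section bernstein_calculus.
Context (R : realType) (g : R -> R).
Hypothesis bg : bernstein g.
Local Notation leb := (@lebesgue_measure R).
Implicit Types (s t x y l M e : R) (n k : nat).
Local Notation dg n := (derive1n n g : R -> R).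

Lemma bernstein_is_derive n s : 0 < s -> is_derive s 1 (dg n) (dg n.+1 s).
Proof.
move=> s0; apply: DeriveDef; first exact: bernstein_smooth bg n s s0.
by rewrite derive1nS derive1E.
Qed.

Lemma bernstein_continuous n s : 0 < s -> {for s, continuous (dg n)}.
Proof.
by move=> s0; apply/differentiable_continuous/derivable1_diffP; exact: bernstein_smooth bg n s s0.
Qed.

Lemma bernstein_within n x y : 0 < x -> {within `[x, y], continuous (dg n)}.
Proof.
move=> x0; apply: continuous_in_subspaceT => s; rewrite inE/= in_itv/= => /andP[xs _].
by apply: bernstein_continuous; exact: lt_le_trans xs.
Qed.

Lemma bernstein_MVT n x y : 0 < x -> x <= y ->
  exists2 c, c \in `[x, y] & dg n y - dg n x = dg n.+1 c * (y - x).
Proof.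
move=> x0 xy; apply: MVT_segment => //; last exact: bernstein_within.
move=> c; rewrite in_itv/= => /andP[xc _]; apply: bernstein_is_derive.
exact: lt_trans xc.
Qed.

Lemma bernstein_nd x y : 0 < x -> x <= y -> g x <= g y.
Proof.
move=> x0 xy; have [c] := bernstein_MVT 0 x0 xy; rewrite in_itv/= => /andP[xc _] /= E.
rewrite -subr_ge0 E mulr_ge0 ?subr_ge0//.
by have := @bernstein_sign _ _ bg 1 c isT (lt_le_trans x0 xc); rewrite expr0 mul1r.
Qed.

Lemma bernstein_derive_ni x y : 0 < x -> x <= y -> dg 1 y <= dg 1 x.
Proof.
move=> x0 xy; have [c] := bernstein_MVT 1 x0 xy; rewrite in_itv/= => /andP[xc _] E.
rewrite -subr_le0 E mulr_le0_ge0 ?subr_ge0//.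
have := @bernstein_sign _ _ bg 2 c isT (lt_le_trans x0 xc).
by rewrite /= expr1 mulN1r oppr_ge0.
Qed.

(** Increments decrease because [g] is concave; this makes [g (l + e) - g l] small
    uniformly in [l]. *)
Lemma bernstein_increment x y e : 0 < x -> x <= y -> 0 <= e ->
  g (y + e) - g y <= g (x + e) - g x.
Proof.
move=> x0 xy e0.
have dh (t : R) : 0 < t ->
    is_derive t 1 (fun s => g (s + e) - g s) (dg 1 (t + e) - dg 1 t).
  move=> t0; have d1 := bernstein_is_derive 0 t0.
  have d2 := bernstein_is_derive 0 (ltr_wpDr e0 t0).
  have d3 : is_derive t 1 (fun s : R => s + e) 1.
    have H := is_deriveD (is_derive_id t 1) (is_derive_cst e t 1).
    by apply: is_derive_eq H _; rewrite addr0.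
  have H := is_deriveB (is_derive1_comp (g := fun s : R => s + e) d2 d3) d1.
  by apply: is_derive_eq H _; rewrite ?mulr1 ?scale1r.
have [c] : exists2 c, c \in `[x, y] & (g (y + e) - g y) - (g (x + e) - g x) =
    (dg 1 (c + e) - dg 1 c) * (y - x).
  apply: (@MVT_segment _ (fun s => g (s + e) - g s) (fun s => dg 1 (s + e) - dg 1 s)) => //.
    by move=> c; rewrite in_itv/= => /andP[xc _]; apply: dh; exact: lt_trans xc.
  apply: continuous_in_subspaceT => s; rewrite inE/= in_itv/= => /andP[xs _].
  have [/derivable1_diffP/differentiable_continuous + _] := dh s (lt_le_trans x0 xs).
  exact.
rewrite in_itv/= => /andP[xc _] E.
rewrite -subr_le0 E mulr_le0_ge0 ?subr_ge0// subr_le0.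
by apply: bernstein_derive_ni; [exact: lt_le_trans xc|rewrite lerDl].
Qed.

Definition bernstein0 := inf (g @` `]0, +oo[).

Lemma bernstein0_cvg : g s @[s --> 0^'+] --> bernstein0.
Proof.
apply: (@nondecreasing_at_right_cvgr _ _ _ +oo%O) => //.
- by move=> x y; rewrite !in_itv/= !andbT => x0 y0 xy; exact: bernstein_nd.
- exists 0 => _ [s + <-]; rewrite /= in_itv/= andbT => s0; exact/ltW/(bernstein_gt0 bg).
Qed.

Lemma bernstein0_le s : 0 < s -> bernstein0 <= g s.
Proof.
move=> s0; apply: ge_inf; last by exists s => //; rewrite /= in_itv/= s0.
by exists 0 => _ [t + <-]; rewrite /= in_itv/= andbT => t0; exact/ltW/(bernstein_gt0 bg).
Qed.

Lemma bernstein0_ge0 : 0 <= bernstein0.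
Proof.
apply: lb_le_inf; first by exists (g 1), 1 => //; rewrite /= in_itv/= ltr01.
by move=> _ [t + <-]; rewrite /= in_itv/= andbT => t0; exact/ltW/(bernstein_gt0 bg).
Qed.

Lemma lim_zeroE : lim_zero g = bernstein0%:E.
Proof.
apply: cvg_lim => //; apply/cvg_EFin; first exact: nearW.
exact: bernstein0_cvg.
Qed.

(** As a function of its centre [s], the Taylor polynomial of order [n] at a fixed
    point [y] has a telescoping derivative. *)
Lemma is_derive_taylor y n s : 0 < s ->
  is_derive s 1 (fun s => \sum_(k < n.+1) dg k s / k`!%:R * (y - s) ^+ k)
    (dg n.+1 s / n`!%:R * (y - s) ^+ n).
Proof.
move=> s0; elim: n => [|n IH].
  rewrite (_ : (fun _ => _) = g); last first.
    by apply/funext => t; rewrite big_ord1 expr0 mulr1 divr1.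
  by rewrite expr0 mulr1 divr1; exact: (bernstein_is_derive 0).
rewrite (_ : (fun _ => _) = (fun s => \sum_(k < n.+1) dg k s / k`!%:R * (y - s) ^+ k) +
    (n.+1`!%:R^-1 *: (dg n.+1 : R -> R)) * ((cst y - id) ^+ n.+1)); last first.
  apply/funext => t; rewrite big_ord_recr/=; congr (_ + _).
  by rewrite !fctE [_ / _]mulrC.
have dn := bernstein_is_derive n.+1 s0.
have H := is_deriveD IH (is_deriveM (is_deriveZ n.+1`!%:R^-1 dn)
  (is_deriveX n.+1 (is_deriveB (is_derive_cst y s 1) (is_derive_id s 1)))).
apply: is_derive_eq H _.
rewrite !fctE /GRing.scale /= factS natrM.
set a := dg n.+1 s; set b := dg n.+2 s; set z := y - s.
rewrite exprS sub0r [X in _ + (X * _ + _)](_ : _ = (n.+1%:R * n`!%:R)^-1 * a)//.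
rewrite /a /b /=; field.
by rewrite pnatr_eq0 -lt0n fact_gt0 gt_eqF// ltr_pwDl.
Qed.

(** Coefficients of the Taylor polynomial at [s] in powers of [s - y], up to the
    sign that makes them nonnegative for a Bernstein function. *)
Definition taylor_coef n s : R := (-1) ^+ n * dg n.+1 s / n.+1`!%:R.
Definition taylor_weight n s : R := (-1) ^+ n * dg n.+1 s / n`!%:R.

Lemma taylor_coef_ge0 n s : 0 < s -> 0 <= taylor_coef n s.
Proof. by move=> s0; rewrite divr_ge0//; exact: (@bernstein_sign _ _ bg n.+1 s). Qed.

Lemma taylor_weight_ge0 n s : 0 < s -> 0 <= taylor_weight n s.
Proof. by move=> s0; rewrite divr_ge0//; exact: (@bernstein_sign _ _ bg n.+1 s). Qed.

Lemma taylor_weight_within n x y : 0 < x -> {within `[x, y], continuous (taylor_weight n)}.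
Proof.
move=> x0; apply: continuous_in_subspaceT => s; rewrite inE/= in_itv/= => /andP[xs _].
have s0 := lt_le_trans x0 xs.
apply: cvgM; last exact: cvg_cst.
by apply: cvgM; [exact: cvg_cst|exact: bernstein_continuous].
Qed.

(** Taylor formula with integral remainder, read at the left of its centre [M]:
    the signs of the derivatives make all terms nonnegative. *)
Lemma bernstein_taylor n y M : 0 < y -> y <= M ->
  ((g M - g y)%:E = (\sum_(k < n) taylor_coef k M * (M - y) ^+ k.+1)%:E +
   \int[leb]_(s in `[y, M]) (taylor_weight n s * (s - y) ^+ n)%:E)%E.
Proof.
move=> y0 yM.
pose P s := \sum_(k < n.+1) dg k s / k`!%:R * (y - s) ^+ k.
have Pd s : 0 < s -> is_derive s 1 P (taylor_weight n s * (s - y) ^+ n).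
  move=> s0; have H := is_derive_taylor y n s0; apply: is_derive_eq H _.
  rewrite /taylor_weight -[s - y]opprB [(- (y - s)) ^+ n]exprNn.
  have : (-1) ^+ n * (-1) ^+ n = 1 :> R by rewrite -expr2 sqrr_sign.
  move=> /(congr1 (fun z => dg n.+1 s / n`!%:R * (y - s) ^+ n * z)); rewrite mulr1 => <-.
  ring.
have PM : P M = g M - \sum_(k < n) taylor_coef k M * (M - y) ^+ k.+1.
  rewrite /P big_ord_recl expr0 mulr1 divr1 -sumrN; congr (_ + _).
  apply: eq_bigr => k _; rewrite lift0 /taylor_coef.
  rewrite -[y - M]opprB [(- (M - y)) ^+ _]exprNn (exprS (-1)); ring.
have Py : P y = g y.
  rewrite /P big_ord_recl/= expr0 mulr1 divr1 big1 ?addr0// => k _.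
  by rewrite subrr expr0n/= mulr0.
have -> : (\int[leb]_(s in `[y, M]) (taylor_weight n s * (s - y) ^+ n)%:E = (P M - P y)%:E)%E.
  move: yM; rewrite le_eqVlt => /predU1P[<-|yM].
    by rewrite subrr set_itv1 integral_set1.
  have cP s : 0 < s -> P x @[x --> s] --> P s.
    move=> s0; have [/derivable1_diffP/differentiable_continuous + _] := Pd s s0.
    exact.
  rewrite (continuous_FTC2 yM (F := P)) ?EFinB//.
  - apply: continuous_in_subspaceT => s; rewrite inE/= in_itv/= => /andP[ys _].
    have s0 := lt_le_trans y0 ys.
    apply: cvgM.
      apply: cvgM; last exact: cvg_cst.
      by apply: cvgM; [exact: cvg_cst|exact: bernstein_continuous].
    apply: (@cvg_comp _ _ _ (fun s => s - y) (fun z => z ^+ n)); last exact: exprn_continuous.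
    by apply: cvgB => //; exact: cvg_cst.
  - split.
    + by move=> s; rewrite in_itv/= => /andP[/(lt_trans y0) s0 _]; have [] := Pd s s0.
    + by apply: cvg_at_right_filter; exact: cP.
    + by apply: cvg_at_left_filter; apply: cP; exact: lt_trans yM.
  - move=> s; rewrite in_itv/= => /andP[/(lt_trans y0) s0 _].
    by have dPs := Pd s s0; rewrite derive1E derive_val.
by rewrite -EFinD PM Py; congr EFin; ring.
Qed.

Definition pospart (z : R) := Num.max 0 z.

Lemma pospart_ge0 z : 0 <= pospart z. Proof. by rewrite le_max lexx. Qed.
Lemma pospartE z : 0 <= z -> pospart z = z. Proof. by move=> /max_idPr. Qed.
Lemma pospart0 z : z <= 0 -> pospart z = 0. Proof. by move=> /max_idPl. Qed.

(** Below the level [M], [g M - g] is a mixture with nonnegative weights of the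
    splines [pospart (s - y) ^+ k].  The formula holds on both sides of [M], as
    everything vanishes beyond [M]. *)
Lemma bernstein_taylor_pos n y e M : (0 < n)%N -> 0 < e -> e <= y -> e <= M ->
  ((pospart (g M - g y))%:E = \sum_(k < n) (taylor_coef k M * pospart (M - y) ^+ k.+1)%:E +
   \int[leb]_(s in `[e, M]) (taylor_weight n s * pospart (s - y) ^+ n)%:E)%E.
Proof.
move=> n0 e0 ey eM; have y0 := lt_le_trans e0 ey.
case: (leP y M) => [yM|/ltW My].
  rewrite pospartE ?subr_ge0 ?bernstein_nd// (bernstein_taylor n y0 yM) -sumEFin.
  rewrite (pospartE (_ : 0 <= M - y)) ?subr_ge0//; congr (_ + _)%E.
  rewrite integral_mkcond [RHS]integral_mkcond; apply: eq_integral => s _.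
  rewrite !patchE !mem_setE !in_itv/=; case: (leP y s) => [ys|/ltW sy] /=.
    by rewrite (le_trans ey ys)/= pospartE ?subr_ge0.
  by case: ifP => // _; rewrite pospart0 ?subr_le0// expr0n gtn_eqF// mulr0.
rewrite pospart0 ?subr_le0; last by apply: bernstein_nd => //; exact: lt_le_trans eM.
rewrite big1 ?add0e => [|k _]; last by rewrite pospart0 ?subr_le0// expr0n mulr0.
rewrite integral0_eq// => s; rewrite /= in_itv/= => /andP[es sM].
by rewrite pospart0 ?subr_le0 ?(le_trans sM)// expr0n gtn_eqF// mulr0.
Qed.

End bernstein_calculus.

(** * Comparison of resolvent powers with splines *)

Section resolvent_power_bound.
Context (R : realType).
Implicit Types (a t x b c del : R).

Lemma bernoulli_pow k a : 0 <= a ->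
  1 + k%:R * a + (k%:R * (k%:R - 1) / 2) * a ^+ 2 <= (1 + a) ^+ k.
Proof.
move=> a0; elim: k => [|k IH]; first by rewrite expr0; lra.
have h : 0 <= 1 + a by lra.
rewrite (exprS (1 + a)); apply: (@le_trans _ _ ((1 + a) * (1 + k%:R * a + (k%:R * (k%:R - 1) / 2) * a ^+ 2)));
  last exact: ler_wpM2l.
have k0 : 0 <= k%:R :> R by [].
have : 0 <= k%:R * (k%:R - 1) :> R.
  by case: k {IH k0} => [|k]; rewrite ?mul0r// mulr_ge0// -natr1; lra.
move=> kk; have a3 : 0 <= a ^+ 3 by rewrite exprn_ge0.
have := mulr_ge0 kk a3.
rewrite -natr1 !exprS expr0; lra.
Qed.

Lemma bernoulli_pow1 k a : 0 <= a <= 1 -> 1 - k%:R * a <= (1 - a) ^+ k.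
Proof.
move=> /andP[a0 a1]; elim: k => [|k IH]; first by rewrite expr0; lra.
have h : 0 <= 1 - a by lra.
rewrite (exprS (1 - a)); apply: (@le_trans _ _ ((1 - a) * (1 - k%:R * a))); last exact: ler_wpM2l.
have : 0 <= k%:R * a ^+ 2 by rewrite mulr_ge0// sqr_ge0.
rewrite -natr1 expr2; lra.
Qed.

(** The power [(1 + a)^-1 ^+ k] lies close to the spline [(1 - a)_+ ^+ k], with an
    error proportional to [1] minus the spline.  It suffices that
    [k a^2 <= del ((1 + a)^k - 1)], and the binomial expansion gives this from its
    linear term when [a <= del] and from its quadratic term when [k] is large. *)
Lemma resolvent_power_le k a del : (0 < k)%N -> 0 <= a -> 0 <= del ->
  a <= del \/ 2 <= del * (k%:R - 1) ->
  (1 + a)^-1 ^+ k <= del + (1 - del) * Num.max 0 (1 - a) ^+ k.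
Proof.
move=> k0 a0 del0 adel.
set be := (1 + a)^-1 ^+ k; set p := _ ^+ k.
have a1 : 0 < 1 + a by lra.
have be0 : 0 < be by rewrite exprn_gt0 ?invr_gt0.
have beE : be * (1 + a) ^+ k = 1.
  by rewrite /be -exprMn mulVf ?expr1n// gt_eqF.
have k1 : 1 <= k%:R :> R by rewrite ler1n.
have p_le : p <= be.
  rewrite lerXn2r ?nnegrE ?le_max ?lexx ?invr_ge0 ?(ltW a1)//.
  rewrite ge_max invr_ge0 (ltW a1)/= -[leRHS]mul1r ler_pdivlMr//.
  have := sqr_ge0 a; rewrite expr2; lra.
have H1 : be - p <= k%:R * a ^+ 2 * be.
  case: (leP a 1) => a1'.
    have -> : p = be * (1 - a ^+ 2) ^+ k.
      rewrite /p (max_idPr _) ?subr_ge0//.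
      have -> : 1 - a ^+ 2 = (1 + a) * (1 - a) by ring.
      by rewrite exprMn mulrA beE mul1r.
    have : 1 - k%:R * a ^+ 2 <= (1 - a ^+ 2) ^+ k.
      by apply: bernoulli_pow1; rewrite sqr_ge0 expr_le1.
    move=> /(ler_wpM2l (ltW be0)); lra.
  have p0 : 0 <= p by rewrite exprn_ge0// le_max lexx.
  have : 1 <= k%:R * a ^+ 2.
    by rewrite -[leLHS]mulr1 ler_pM// exprn_ege1// ltW.
  move=> /(ler_wpM2r (ltW be0)); lra.
have H2 : k%:R * a ^+ 2 * be <= del * (1 - be).
  have : k%:R * a ^+ 2 <= del * ((1 + a) ^+ k - 1).
    have := bernoulli_pow k a0; set z := (1 + a) ^+ k => B.
    have k2 : 0 <= k%:R * (k%:R - 1) / 2 * a ^+ 2.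
      by rewrite mulr_ge0 ?sqr_ge0// divr_ge0// mulr_ge0//; lra.
    case: adel => ad.
      apply: (@le_trans _ _ (del * (k%:R * a))); last by rewrite ler_wpM2l//; lra.
      by rewrite [leRHS]mulrCA ler_wpM2l// expr2 ler_wpM2r.
    apply: (@le_trans _ _ (del * (k%:R * (k%:R - 1) / 2 * a ^+ 2))); last first.
      have ka0 : 0 <= k%:R * a by rewrite mulr_ge0.
      by rewrite ler_wpM2l//; lra.
    have : 0 <= k%:R * a ^+ 2 by rewrite mulr_ge0 ?sqr_ge0.
    move=> K; have ad' : 0 <= del * (k%:R - 1) - 2 by rewrite subr_ge0.
    have := mulr_ge0 ad' K; lra.
  have E : del * (1 - be) = del * ((1 + a) ^+ k - 1) * be by rewrite -{1}beE; ring.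
  by rewrite E; exact: ler_wpM2r (ltW be0) _ _.
have : del * (1 - be) <= del * (1 - p) by rewrite ler_wpM2l//; lra.
lra.
Qed.

End resolvent_power_bound.

(** * From spline inequalities to Bernstein inequalities *)

Section bernstein_integral.
Context (R : realType).
Variable nu : {sigma_finite_measure set (measurableTypeR R) -> \bar R}.
Variables (x b c : R).
Hypotheses (x0 : 0 < x) (b0 : 0 <= b) (c0 : 0 <= c).
Hypothesis nu_mass : nu `[0, +oo[%classic = (b + c)%:E.
Hypothesis nuH : forall (k : nat) (s : R), 0 < s ->
  (\int[nu]_(l in `[0%R, +oo[) (pospart (1 - l / s) ^+ k)%:E <= (b + c * (1 + x / s)^-1 ^+ k)%:E)%E.
Local Notation leb := (@lebesgue_measure R).
Implicit Types (s t l M e del : R) (n k : nat).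

Let D0 t : t \in `[(0 : R), +oo[%classic -> 0 <= t.
Proof. by rewrite inE/= in_itv/= andbT. Qed.

Lemma measurable_pospart : measurable_fun setT (@pospart R).
Proof. by apply: measurable_maxr. Qed.

Let measurable_spline k t : measurable_fun setT (fun l => (pospart (t - l) ^+ k)%:E).
Proof.
apply/measurable_EFinP; apply: measurable_funX.
apply: (measurableT_comp measurable_pospart); exact: measurable_funB.
Qed.

(** The hypothesis on resolvent powers, rewritten with splines on both sides: the
    right-hand side is then a combination of the values of the spline at [0] and
    at [x], the same for all splines. *)
Lemma spline_le k t del : (0 < k)%N -> 0 <= t -> 0 <= del -> del <= 1 ->
  x <= del * t \/ 2 <= del * (k%:R - 1) ->
  (\int[nu]_(l in `[0%R, +oo[) (pospart (t - l) ^+ k)%:E <=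
   ((b + c * del) * pospart t ^+ k + c * (1 - del) * pospart (t - x) ^+ k)%:E)%E.
Proof.
move=> k0 t0 del0 del1 xdel; have [t00|tn0] := eqVneq t 0.
  rewrite integral0_eq; last first.
    by move=> l; rewrite /= in_itv/= andbT => l0; rewrite t00 sub0r pospart0 ?oppr_le0// expr0n gtn_eqF.
  rewrite lee_fin; apply: addr_ge0; apply: mulr_ge0; rewrite ?exprn_ge0 ?pospart_ge0//.
    by rewrite addr_ge0// mulr_ge0.
  by rewrite mulr_ge0// subr_ge0.
have tp : 0 < t by rewrite lt_def tn0.
have posM z : pospart (t * z) = t * pospart z by rewrite /pospart maxr_pMr// mulr0.
have -> : (\int[nu]_(l in `[0%R, +oo[) (pospart (t - l) ^+ k)%:E =
    \int[nu]_(l in `[0%R, +oo[) ((t ^+ k)%:E * (pospart (1 - l / t) ^+ k)%:E))%E.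
  apply: eq_integral => l _; rewrite -EFinM -exprMn -posM; congr (pospart _ ^+ _)%:E.
  by field.
have mk : measurable_fun setT (fun l => pospart (1 - l / t) ^+ k).
  apply: measurable_funX; apply: (measurableT_comp measurable_pospart).
  by apply: measurable_funB => //; exact: measurable_funM.
rewrite ge0_integralZl//; last 3 first.
- exact/measurable_EFinP/measurable_funTS.
- by move=> l _; rewrite lee_fin exprn_ge0 ?pospart_ge0.
- by rewrite lee_fin exprn_ge0.
apply: (@le_trans _ _ ((t ^+ k)%:E * (b + c * (1 + x / t)^-1 ^+ k)%:E)%E).
  by rewrite lee_wpmul2l ?lee_fin ?exprn_ge0//; exact: nuH.
rewrite -EFinM lee_fin (pospartE t0).
have xt0 : 0 <= x / t by rewrite divr_ge0// ltW.
have xdel' : x / t <= del \/ 2 <= del * (k%:R - 1).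
  by case: xdel => H; [left; rewrite ler_pdivrMr|right].
have := resolvent_power_le k0 xt0 del0 xdel'.
rewrite -/(pospart _).
have -> : pospart (t - x) ^+ k = t ^+ k * pospart (1 - x / t) ^+ k.
  by rewrite -exprMn -posM mulrBr mulr1 mulrCA divff// mulr1.
move=> /(ler_wpM2l c0) /(ler_wpM2l (exprn_ge0 k t0)); lra.
Qed.

Variable g : R -> R.
Hypothesis bg : bernstein g.

Let A del := b + c * del.
Let B del := c * (1 - del).

(** Integrate [spline_le] against the weights of [bernstein_taylor_pos].  The
    spline of highest order [n] is used with all knots, hence the condition on
    [n]; those of lower order occur only with the far knot [M], hence the condition
    on [M]. *)
Lemma bernstein_truncated_le n M e del : (0 < n)%N -> 0 < e -> e <= M -> 0 <= del -> del <= 1 ->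
  x <= del * (M - e) -> 2 <= del * (n%:R - 1) ->
  (\int[nu]_(l in `[0%R, +oo[) (pospart (g M - g (l + e)))%:E <=
   (A del * pospart (g M - g e) + B del * pospart (g M - g (x + e)))%:E)%E.
Proof.
move=> n0 e0 eM del0 del1 xM ndel.
have M0 : 0 < M := lt_le_trans e0 eM.
have Me0 : 0 <= M - e by rewrite subr_ge0.
have A0 : 0 <= A del by rewrite /A addr_ge0// mulr_ge0.
have B0 : 0 <= B del by rewrite /B mulr_ge0// subr_ge0.
pose w := taylor_weight g n \_ `[e, M].
have w0 s : 0 <= w s.
  rewrite /w patchE; case: ifPn => //; rewrite inE/= in_itv/= => /andP[es _].
  by apply: taylor_weight_ge0 => //; exact: lt_le_trans es.
have mw : measurable_fun setT w.
  apply/(measurable_restrictT _ _).1 => //.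
  apply: subspace_continuous_measurable_fun => //.
  exact: taylor_weight_within.
pose F (z : measurableTypeR R * measurableTypeR R) : \bar R :=
  (w z.2 * pospart (z.2 - (z.1 + e)) ^+ n * \1_(`[0, +oo[%classic : set R) z.1)%:E.
have F0 z : (0 <= F z)%E by rewrite lee_fin !mulr_ge0 ?exprn_ge0 ?pospart_ge0.
have mF : measurable_fun setT F.
  apply/measurable_EFinP; apply: measurable_funM.
    apply: measurable_funM; first exact: measurableT_comp.
    apply: measurable_funX; apply: (measurableT_comp measurable_pospart).
    by apply: measurable_funB => //; exact: measurable_funD.
  by apply: measurableT_comp => //.
have IE l : 0 <= l -> (\int[leb]_(s in `[e, M]) (taylor_weight g n s * pospart (s - (l + e)) ^+ n)%:E =
    fubini_F leb F l)%E.
  move=> l0; rewrite /fubini_F [LHS]integral_mkcond; apply: eq_integral => s _.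
  have i1 : \1_(`[0, +oo[%classic : set R) l = 1 :> R.
    by rewrite indicE mem_set//= in_itv/= l0.
  rewrite /F /w /= !patchE i1 mulr1.
  by case: ifP => // _; rewrite mul0r.
have mI := measurable_fun_fubini_tonelli_F (m2 := leb) F mF F0.
have I0 l : (0 <= fubini_F leb F l)%E by apply: integral_ge0.
have ptw l : 0 <= l -> ((pospart (g M - g (l + e)))%:E =
    \sum_(k < n) (taylor_coef g k M * pospart (M - (l + e)) ^+ k.+1)%:E + fubini_F leb F l)%E.
  by move=> l0; rewrite -IE// -(bernstein_taylor_pos bg n0 e0 _ eM) ?lerDr.
have d0 k : 0 <= taylor_coef g k M by exact: taylor_coef_ge0.
have opp s l : s - (l + e) = s - e - l by rewrite opprD addrA addrAC.
have mK k t : measurable_fun setT (fun l => (taylor_coef g k M * pospart (t - (l + e)) ^+ k.+1)%:E).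
  apply/measurable_EFinP; apply: measurable_funM => //; apply: measurable_funX.
  apply: (measurableT_comp measurable_pospart); apply: measurable_funB => //.
  exact: measurable_funD.
pose Q k s := A del * pospart (s - e) ^+ k + B del * pospart (s - (x + e)) ^+ k.
have Q0 k s : 0 <= Q k s by rewrite addr_ge0// mulr_ge0// exprn_ge0// pospart_ge0.
have -> : (\int[nu]_(l in `[0%R, +oo[) (pospart (g M - g (l + e)))%:E = \int[nu]_(l in `[0%R, +oo[)
    (\sum_(k < n) (taylor_coef g k M * pospart (M - (l + e)) ^+ k.+1)%:E + fubini_F leb F l))%E.
  by apply: eq_integral => l /D0 l0; rewrite ptw.
have mS : measurable_fun setT
    (fun l => \sum_(k < n) (taylor_coef g k M * pospart (M - (l + e)) ^+ k.+1)%:E)%E.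
  by apply: emeasurable_sum => k; exact: mK.
have S0 l : (0 <= \sum_(k < n) (taylor_coef g k M * pospart (M - (l + e)) ^+ k.+1)%:E)%E.
  by apply: sume_ge0 => k _; rewrite lee_fin mulr_ge0// exprn_ge0// pospart_ge0.
rewrite ge0_integralD//; [|exact: measurable_funTS mS|exact: measurable_funTS mI].
rewrite ge0_integral_sum//; last 2 first.
- by move=> k; apply: measurable_funTS; exact: mK.
- by move=> k l _; rewrite lee_fin mulr_ge0// exprn_ge0// pospart_ge0.
have sumle : (\sum_(k < n) \int[nu]_(l in `[0%R, +oo[) (taylor_coef g k M * pospart (M - (l + e)) ^+ k.+1)%:E
    <= \sum_(k < n) (taylor_coef g k M * Q k.+1 M)%:E)%E.
  apply: lee_sum => k _.
  under eq_integral do rewrite EFinM opp.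
  rewrite ge0_integralZl//; last 3 first.
  - by apply: measurable_funTS; exact: measurable_spline.
  - by move=> l _; rewrite lee_fin exprn_ge0// pospart_ge0.
  - by rewrite lee_fin.
  rewrite [leRHS]EFinM lee_wpmul2l ?lee_fin// /Q opp.
  by apply: spline_le => //; left.
have mQ k : measurable_fun setT (Q k).
  have mp z : measurable_fun setT (fun s => pospart (s - z) ^+ k).
    apply: measurable_funX; apply: (measurableT_comp measurable_pospart).
    exact: measurable_funB.
  by apply: measurable_funD; apply: measurable_funM.
have intle : (\int[nu]_(l in `[0%R, +oo[) fubini_F leb F l
    <= \int[leb]_(s in `[e, M]) (taylor_weight g n s * Q n s)%:E)%E.
  rewrite integral_mkcond.
  rewrite (eq_integral (fubini_F leb F)); last first.
    move=> l _; rewrite patchE; case: ifPn => //; rewrite notin_setE/= in_itv/= andbT => l0.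
    rewrite /fubini_F integral0_eq// => s _; rewrite /F /= indicE memNset ?mulr0//.
    by rewrite /= in_itv/= andbT.
  rewrite (fubini_tonelli (m1 := nu) (m2 := leb) F mF F0) [leRHS]integral_mkcond.
  apply: ge0_le_integral => //.
  - by move=> s _; apply: integral_ge0.
  - exact: (measurable_fun_fubini_tonelli_G (m1 := nu) F mF F0).
  - rewrite (_ : _ \_ _ = fun s => (w s * Q n s)%:E); last first.
      by apply/funext => s; rewrite /w !patchE; case: ifP => // _; rewrite mul0r.
    by apply/measurable_EFinP; apply: measurable_funM; [exact: mw|exact: mQ].
  - move=> s _; rewrite patchE.
    have -> : (\int[nu]_l F (l, s) = (w s)%:E * \int[nu]_(l in `[0%R, +oo[) (pospart (s - e - l) ^+ n)%:E)%E.
      rewrite -ge0_integralZl//; last 3 first.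
      - by apply: measurable_funTS; exact: measurable_spline.
      - by move=> l _; rewrite lee_fin exprn_ge0// pospart_ge0.
      - by rewrite lee_fin.
      rewrite [RHS]integral_mkcond; apply: eq_integral => l _.
      rewrite patchE /F/= indicE; case: ifPn => [_|_]; last by rewrite mulr0.
      by rewrite mulr1 opp EFinM.
    rewrite /w patchE; case: ifPn => [|_]; last by rewrite mul0e.
    rewrite inE/= in_itv/= => /andP[es _].
    rewrite [leRHS]EFinM lee_wpmul2l ?lee_fin//; first by apply: taylor_weight_ge0 => //; exact: lt_le_trans es.
    by rewrite /Q opp; apply: spline_le; rewrite ?subr_ge0//; right.
apply: le_trans (leeD sumle intle) _.
(* the upper bound is a combination of two instances of the same expansion *)
have T0 := bernstein_taylor_pos bg n0 e0 (lexx e) eM.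
have ex : e <= x + e by rewrite lerDr ltW.
have Tx := bernstein_taylor_pos bg n0 e0 ex eM.
have mW z : measurable_fun (`[e, M]%classic : set R) (fun s => (taylor_weight g n s * pospart (s - z) ^+ n)%:E).
  apply/measurable_EFinP; apply: measurable_funM.
    apply: subspace_continuous_measurable_fun => //; exact: taylor_weight_within.
  apply: measurable_funTS; apply: measurable_funX; apply: (measurableT_comp measurable_pospart).
  exact: measurable_funB.
have W0 z s : s \in `[e, M] -> (0 <= (taylor_weight g n s * pospart (s - z) ^+ n)%:E)%E.
  rewrite in_itv/= => /andP[es _]; rewrite lee_fin mulr_ge0 ?exprn_ge0 ?pospart_ge0//.
  by apply: taylor_weight_ge0 => //; exact: lt_le_trans es.
have -> : (\int[leb]_(s in `[e, M]) (taylor_weight g n s * Q n s)%:E =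
    (A del)%:E * \int[leb]_(s in `[e, M]) (taylor_weight g n s * pospart (s - e) ^+ n)%:E
    + (B del)%:E * \int[leb]_(s in `[e, M]) (taylor_weight g n s * pospart (s - (x + e)) ^+ n)%:E)%E.
  rewrite -!ge0_integralZl//; try (by move=> s; exact: W0); last 2 first.
  - exact: mW.
  - exact: mW.
  rewrite -ge0_integralD//; last 4 first.
  - by move=> s sI; apply: mule_ge0; [rewrite lee_fin|exact: W0].
  - by apply: emeasurable_funM => //; exact: mW.
  - by move=> s sI; apply: mule_ge0; [rewrite lee_fin|exact: W0].
  - by apply: emeasurable_funM => //; exact: mW.
  by apply: eq_integral => s _; rewrite -!EFinM -EFinD /Q; congr EFin; ring.
have Eint a I (z : R) : (z%:E = a%:E + I)%E -> (I = (z - a)%:E)%E.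
  by move=> H; rewrite EFinB H addeAC subee// add0e.
rewrite !sumEFin in T0 Tx *.
rewrite (Eint _ _ _ T0) (Eint _ _ _ Tx) -!EFinM -!EFinD lee_fin.
have -> : \sum_(k < n) taylor_coef g k M * Q k.+1 M =
    A del * (\sum_(k < n) taylor_coef g k M * pospart (M - e) ^+ k.+1) +
    B del * (\sum_(k < n) taylor_coef g k M * pospart (M - (x + e)) ^+ k.+1).
  by rewrite !mulr_sumr -big_split/=; apply: eq_bigr => k _; rewrite /Q; ring.
lra.
Qed.

(* a bound on the cost of replacing g by its shift g (. + e), which is smooth at 0 *)
Let K e := g (e + e) - bernstein0 g.

Lemma ext_zeroE l : ext_zero g l = if 0 < l then g l else bernstein0 g.
Proof. by rewrite /ext_zero (lim_zeroE bg). Qed.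

Lemma ext_zero_nd : {homo ext_zero g : s t / s <= t}.
Proof.
move=> s t st; rewrite !ext_zeroE; case: ifPn => s0; case: ifPn => t0 //.
- exact: bernstein_nd.
- by move: t0; rewrite (lt_le_trans s0 st).
- exact: bernstein0_le.
Qed.

Lemma ext_zero_ge0 l : 0 <= ext_zero g l.
Proof.
rewrite ext_zeroE; case: ifPn => l0; first exact/ltW/(bernstein_gt0 bg).
exact: bernstein0_ge0.
Qed.

Lemma measurable_ext_zero : measurable_fun setT (ext_zero g).
Proof. by apply: nondecreasing_measurable => //; exact: ext_zero_nd. Qed.

Lemma bernstein_shift_le l e : 0 <= l -> 0 < e -> g (l + e) <= ext_zero g l + K e.
Proof.
move=> l0 e0; rewrite ext_zeroE; case: ifPn => [{}l0|l1].
  have t0 : 0 < Num.min l e by rewrite lt_min l0.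
  have tl : Num.min l e <= l by rewrite ge_min lexx.
  have te : Num.min l e + e <= e + e by rewrite lerD2r ge_min lexx orbT.
  have := bernstein_increment bg t0 tl (ltW e0).
  have := bernstein_nd bg (addr_gt0 t0 e0) te.
  have := bernstein0_le bg t0; rewrite /K; lra.
have -> : l = 0 by apply/eqP; rewrite eq_le l0 andbT leNgt.
rewrite add0r /K addrC subrK; apply: bernstein_nd => //; lra.
Qed.

Lemma bernstein_integral_ge_approx e del : 0 < e -> 0 < del -> del <= 1 ->
  ((c * (1 - del) * g x - (b + c) * K e)%:E <=
   \int[nu]_(l in `[0%R, +oo[) (ext_zero g l)%:E)%E.
Proof.
move=> e0 del0 del1.
(* chosen so that both alternatives of [spline_le] are met *)
pose n := (Num.bound (2 / del)).+1.
pose M := e + x / del.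
have xd : x <= x / del by rewrite ler_pdivlMr// ler_piMr// ltW.
have eM : e <= M by rewrite lerDl; apply: le_trans xd; exact: ltW.
have M0 := lt_le_trans e0 eM.
have nd : 2 <= del * (n%:R - 1).
  rewrite (_ : n%:R - 1 = (Num.bound (2 / del))%:R); last by rewrite /n -addn1 natrD addrK.
  rewrite -ler_pdivrMl// mulrC ltW//.
  by rewrite archi_boundP// divr_ge0// ltW.
have xM : x <= del * (M - e) by rewrite /M addrAC subrr add0r mulrCA divff ?gt_eqF// mulr1.
have xeM : x + e <= M by rewrite /M addrC lerD2l.
have T := bernstein_truncated_le (isT : (0 < n)%N) e0 eM (ltW del0) del1 xM nd.
rewrite (pospartE (_ : 0 <= g M - g e)) in T; last by rewrite subr_ge0 bernstein_nd.
rewrite (pospartE (_ : 0 <= g M - g (x + e))) in T; last first.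
  by rewrite subr_ge0 bernstein_nd// addr_gt0.
have K0 : 0 <= K e by rewrite subr_ge0; apply: bernstein0_le => //; exact: addr_gt0.
have mp : measurable_fun (`[0, +oo[%classic : set R) (fun l => (pospart (g M - g (l + e)))%:E).
  apply: (@eq_measurable_fun _ _ _ _ _ (fun l => (pospart (g M - ext_zero g (l + e)))%:E)).
    by move=> l /D0 l0; rewrite ext_zeroE ltr_wpDl.
  apply/measurable_EFinP/measurable_funTS; apply: (measurableT_comp measurable_pospart).
  apply: measurable_funB => //; apply: (measurableT_comp measurable_ext_zero).
  exact: measurable_funD.
have I : ((g M * (b + c))%:E <= \int[nu]_(l in `[0%R, +oo[) (ext_zero g l)%:E
    + \int[nu]_(l in `[0%R, +oo[) (pospart (g M - g (l + e)))%:E + (K e * (b + c))%:E)%E.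
  rewrite !EFinM -nu_mass -!integral_cst//.
  have mx : measurable_fun (`[0, +oo[%classic : set R) (fun l => (ext_zero g l)%:E).
    by apply/measurable_EFinP; apply: measurable_funTS; exact: measurable_ext_zero.
  rewrite -!ge0_integralD//.
  - apply: ge0_le_integral => //.
    + by move=> l _; rewrite lee_fin; exact/ltW/(bernstein_gt0 bg).
    + by apply: emeasurable_funD => //; exact: emeasurable_funD.
    + move=> l; rewrite /= in_itv/= andbT => l0; rewrite -!EFinD lee_fin.
      have := bernstein_shift_le l0 e0; have : g M - g (l + e) <= pospart (g M - g (l + e)).
        by rewrite le_max lexx orbT.
      lra.
  - by move=> l _; rewrite lee_fin addr_ge0 ?ext_zero_ge0 ?pospart_ge0.
  - exact: emeasurable_funD.
  - by move=> l _; rewrite lee_fin ext_zero_ge0.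
  - by move=> l _; rewrite lee_fin pospart_ge0.
have : ((g M * (b + c))%:E <= \int[nu]_(l in `[0%R, +oo[) (ext_zero g l)%:E +
   (A del * (g M - g e) + B del * (g M - g (x + e)) + K e * (b + c))%:E)%E.
  apply: le_trans I _; rewrite -addeA leeD2l// EFinD leeD2r//.
rewrite -leeBlDr// => H; apply: le_trans H; rewrite -EFinB lee_fin.
have A0 : 0 <= A del * g e.
  apply: mulr_ge0; last exact/ltW/(bernstein_gt0 bg).
  by rewrite /A addr_ge0// mulr_ge0// ltW.
have gx : g x <= g (x + e) by apply: bernstein_nd => //; rewrite lerDl ltW.
have B0 : 0 <= B del by rewrite /B mulr_ge0// subr_ge0.
have := ler_wpM2l B0 gx; move: A0; rewrite /A /B; lra.
Qed.

(** Let the order [n], the truncation level [M] and the shift [e] of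
    [bernstein_integral_ge_approx] go to their limits. *)
Lemma bernstein_integral_ge : ((c * g x)%:E <= \int[nu]_(l in `[0%R, +oo[) (ext_zero g l)%:E)%E.
Proof.
apply/lee_addgt0Pr => eta eta0.
have gx0 := bernstein_gt0 bg x0.
have F0 : 0 <= b + c by exact: addr_ge0.
pose del := Num.min 1 (eta / 2 / (c * g x + 1)).
have cg0 : 0 <= c * g x by rewrite mulr_ge0// ltW.
have cg1 : 0 < c * g x + 1 by lra.
have d0 : 0 < del by rewrite lt_min ltr01/= !divr_gt0.
have d1 : del <= 1 by rewrite ge_min lexx.
have cd : del * (c * g x) <= eta / 2.
  apply: (@le_trans _ _ (del * (c * g x + 1))); first by rewrite ler_wpM2l ?(ltW d0)// lerDl.
  by rewrite -ler_pdivlMr// ge_min lexx orbT.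
have [s s0 sK] : exists2 s, 0 < s & (b + c) * (g s - bernstein0 g) <= eta / 2.
  have e1 : 0 < eta / 2 / (b + c + 1) by rewrite !divr_gt0//; lra.
  have /cvgrPdist_le /(_ _ e1) H := bernstein0_cvg bg.
  near (0 : R)^'+ => s; exists s => //.
  have : `|bernstein0 g - g s| <= eta / 2 / (b + c + 1) by near: s.
  rewrite distrC ger0_norm ?subr_ge0 ?bernstein0_le// => Hs.
  have s1 : 0 <= g s - bernstein0 g by rewrite subr_ge0 bernstein0_le.
  move: Hs; rewrite ler_pdivlMr; last by lra.
  rewrite mulrDr mulr1 mulrC; lra.
have e0 : 0 < s / 2 by rewrite divr_gt0.
have := bernstein_integral_ge_approx e0 d0 d1.
rewrite /K -splitr => H; apply: le_trans (leeD2r _ H); rewrite -EFinD lee_fin; lra.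
Unshelve. all: by end_near. Qed.

End bernstein_integral.

(** * Inverse of a Bernstein function *)

Section bernstein_inverse.
Context (R : realType) (g : R -> R).
Hypothesis bg : bernstein g.

Lemma is_cvg_lim_infty : cvg ((g s)%:E @[s --> +oo]).
Proof.
pose f s := (g (Num.max s 1))%:E.
have cf : cvg (f s @[s --> +oo]).
  apply: nondecreasing_is_cvge => s t st; rewrite lee_fin; apply: bernstein_nd => //.
    by rewrite lt_max ltr01 orbT.
  by rewrite ge_max !le_max st lexx orbT.
have fg : {near +oo, f =1 (fun s => (g s)%:E)}.
  by near=> s; rewrite /f (max_idPl _)//; near: s; apply: nbhs_pinfty_ge; exact: num_real.
have /cvg_ex[l fl] := cf; apply/cvg_ex; exists l.
exact: (cvg_trans (near_eq_cvg fg) fl).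
Unshelve. all: by end_near. Qed.

Lemma lim_infty_gtP (y : R) : (y%:E < lim_infty g)%E -> exists2 s, 0 < s & y < g s.
Proof.
move=> yg; apply: contrapT => H; move: yg; apply/negP; rewrite -leNgt.
have gy s : 0 < s -> g s <= y.
  by move=> s0; rewrite leNgt; apply/negP => ys; apply: H; exists s.
apply: lime_le; first exact: is_cvg_lim_infty.
near=> s; rewrite lee_fin; apply: gy.
by near: s; apply: nbhs_pinfty_gt; exact: num_real.
Unshelve. all: by end_near. Qed.

Lemma bernstein_inv (r : R) :
  ((lim_infty g)^-1 < r%:E < (lim_zero g)^-1)%E ->
  [/\ 0 < r, 0 < inv_pos g r^-1 & g (inv_pos g r^-1) = r^-1].
Proof.
move=> /andP[r0 r1].
have L0 : (0 <= lim_infty g)%E.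
  apply: lime_ge; first exact: is_cvg_lim_infty.
  near=> s; rewrite lee_fin; apply/ltW/(bernstein_gt0 bg).
  by near: s; apply: nbhs_pinfty_gt; exact: num_real.
have rp : 0 < r by rewrite -lte_fin (le_lt_trans _ r0)// inve_ge0.
have [s2 s20 s2r] : exists2 s, 0 < s & r^-1 < g s.
  apply: lim_infty_gtP.
  have : (r%:E^-1 < lim_infty g)%E by rewrite inve_plt// inE ?lee_fin ?(ltW rp).
  by rewrite inver gt_eqF.
have [s1 s10 s1r] : exists2 s, 0 < s & g s < r^-1.
  have l0 : (0 <= lim_zero g)%E by rewrite (lim_zeroE bg) lee_fin bernstein0_ge0.
  have : (lim_zero g < r%:E^-1)%E by rewrite inve_pgt// inE ?lee_fin ?(ltW rp).
  rewrite inver gt_eqF// (lim_zeroE bg) lte_fin => H.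
  have hi : has_inf (g @` `]0, +oo[).
    split; first by exists (g 1), 1 => //; rewrite /= in_itv/= ltr01.
    by exists 0 => _ [t + <-]; rewrite /= in_itv/= andbT => t0; exact/ltW/(bernstein_gt0 bg).
  have [_ [s + <-] gs] := inf_lt hi.1 H.
  by rewrite /= in_itv/= andbT => s0; exists s.
have s12 : s1 <= s2.
  rewrite leNgt; apply/negP => /ltW /(bernstein_nd bg s20).
  lra.
have [x] : exists2 x, x \in `[s1, s2] & g x = r^-1.
  apply: IVT => //; first exact: (bernstein_within bg (n := 0)).
  by rewrite ge_min le_max (ltW s1r) (ltW s2r) orbT.
rewrite in_itv/= => /andP[sx _] gx.
have x0 : 0 < x := lt_le_trans s10 sx.
have rg : (g @` `]0, +oo[%classic) r^-1 by exists x => //; rewrite /= in_itv/= x0.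
split => //; last by rewrite /inv_pos pinvK//; exact: mem_set.
have : `]0, +oo[%classic (inv_pos g r^-1).
  apply: (@surjpinv_image_sub _ _ (fun=> 0) `]0, +oo[%classic (g @` `]0, +oo[) g) => //.
  by exists r^-1.
by rewrite /= in_itv/= andbT.
Unshelve. all: by end_near. Qed.

End bernstein_inverse.

(** * The quadratic form of a spectral integral *)

Section spectral_scaling.
Context d (X : measurableType d) (R : realType).
Variable mu : {measure set X -> \bar R}.
Variable E : resolution_of_identity mu.
Implicit Types f : L2 mu.

(** [spectral_form] evaluated at [f, f] involves the spectral measure of [f + f]. *)
Lemma spectral_measure_double f A : measurable A ->
  spectral_measure E (f + f) A = mscale 4%:nng (spectral_measure E f) A.
Proof.
move=> mA; rewrite /spectral_measure.
apply: (lebesgue_stieltjes_measure_unique (mu := mscale 4%:nng (spectral_measure E f))) => //.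
move=> _ [[a b] _ <-] /=.
transitivity (4%:E * spectral_measure E f `]a, b])%E; last by [].
have [ab|ba] := leP a b; last first.
  by rewrite set_itv_ge ?measure0 ?mule0// bnd_simp -leNgt ltW.
rewrite (spectral_measure_oc E f ab) [LHS](spectral_measure_oc E (f + f) ab) -EFinM; congr EFin.
have dbl l : spectral_cdf E (f + f) l = 4 * spectral_cdf E f l.
  rewrite /spectral_cdf.
  have s (x y : L2 mu) : inner mu (E l x) y = inner mu x (E l y) by exact: res_symmetric.
  rewrite s !innerE -s innerE; ring.
by rewrite !dbl /=; ring.
Qed.

Lemma spectral_form_diag f (G : R -> R) : measurable_fun setT G -> (forall l, 0 <= G l) ->
  spectral_form E G f f = fine (\int[spectral_measure E f]_(l in `[0%R, +oo[) (G l)%:E)%E.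
Proof.
move=> mG G0; rewrite /spectral_form /Rintegral.
have mG' : measurable_fun (`[0, +oo[%classic : set R) (EFin \o G).
  by apply/measurable_EFinP; exact: measurable_funTS.
have G0' l : (`[0, +oo[%classic : set R) l -> (0 <= (EFin \o G) l)%E by rewrite /= lee_fin.
have Z : (\int[spectral_measure E (f - f)%R]_(l in `[0%R, +oo[) (G l)%:E = 0)%E.
  apply: null_set_integral => //.
  by rewrite [LHS]spectral_measure_ge0 innerBl subrr.
have D : (\int[spectral_measure E (f + f)%R]_(l in `[0%R, +oo[) (G l)%:E =
    4%:E * \int[spectral_measure E f]_(l in `[0%R, +oo[) (G l)%:E)%E.
  apply: etrans (ge0_integral_mscale (spectral_measure E f) _ 4%:nng mG' G0') => //.
  by apply: eq_measure_integral => A mA _; exact: spectral_measure_double.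
apply: etrans (congr1 ( *%R 4^-1) (f_equal2 (fun a b => fine a - fine b) D Z)) _.
move: (\int[_]_(_ in _) _)%E => [a| |] /=; rewrite subr0.
- by rewrite mulKf.
- by rewrite gt0_muley ?lte_fin//= mulr0.
- by rewrite gt0_muleNy ?lte_fin//= mulr0.
Qed.

End spectral_scaling.

(** * Super-Poincare inequality along powers of the resolvent *)

Section resolvent_iteration.
Context d (X : measurableType d) (R : realType).
Variable mu : {measure set X -> \bar R}.
Variables (T : R -> L2 mu -> L2 mu) (E : resolution_of_identity mu) (beta : R -> R).
Hypothesis TS : contraction_semigroup T.
Hypothesis TE : spectral_resolution_of (neg_generator T) E.
Hypothesis beta0 : forall r : R, 0 < r -> 0 < beta r.
Hypothesis sp : super_poincare (neg_generator T) 0%E +oo%E beta.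
Implicit Types f u h : L2 mu.

(** [u] is [(1 + sigma A)^-k f] with [sigma = 1 / (2 s)].  If [u + sigma A u = w],
    then [|w|^2 >= |u|^2 + 2 sigma (A u, u)], and the super-Poincare inequality at
    [1 / x] bounds [(A u, u)] from below by [x (|u|^2 - B)]; the first norm of [u]
    does not exceed that of [f], so the same [B] serves at each step.  Each
    step thus divides [|u|^2 - B] by at least [1 + x / s]. *)
Lemma resolvent_powers f (x s : R) (k : nat) : 0 < x -> 0 < s -> (f : X -> R) \in Lfun mu 1 ->
  let B := beta x^-1 * pnorm mu 1 f ^+ 2 in
  exists u, [/\ (u : X -> R) \in Lfun mu 1, pnorm mu 1 u <= pnorm mu 1 f,
    inner mu u u - B <= (inner mu f f - B) * (1 + x / s)^-1 ^+ k
    & forall p, (\int[spectral_measure E u]_(l in `[0%R, +oo[) (resolvent_symbol (2 * s)^-1 l ^+ p)%:E =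
        \int[spectral_measure E f]_(l in `[0%R, +oo[) (resolvent_symbol (2 * s)^-1 l ^+ (p + k.*2))%:E)%E].
Proof.
move=> x0 s0 fL B; pose sigma := (2 * s)^-1.
have sigma0 : 0 < sigma by rewrite invr_gt0 mulr_gt0.
elim: k => [|k [u [uL u1 uB uE]]].
  exists f; split => //; first by rewrite expr0 mulr1.
  by move=> p; rewrite addn0.
have [h hE] := resolvent_riesz E sigma0 u.
pose v : L2 mu := u - sigma *: h.
have Avh : neg_generator T v h := proj2 (TE v h) (resolvent_spectral_integral sigma0 hE).
have vhE : v + sigma *: h = u by rewrite subrK.
have vpsi p : (\int[spectral_measure E v]_(l in `[0%R, +oo[) (resolvent_symbol sigma l ^+ p)%:E =
    \int[spectral_measure E u]_(l in `[0%R, +oo[) (resolvent_symbol sigma l ^+ p.+2)%:E)%E.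
  exact: (resolvent_symbolX_transfer sigma0 hE p).
clearbody v; clear hE.
have [] := resolvent_pnorm1 TS sigma0 Avh; rewrite vhE// => vL v1.
refine (ex_intro _ v (And4 vL (le_trans v1 u1) _ _)).
- have := sp Avh vL (r := x^-1); rewrite ltry lte_fin invr_gt0 x0 => /(_ isT).
  rewrite sqr_pnorm2 => spv.
  have vB : inner mu v v <= x^-1 * inner mu h v + B.
    apply: le_trans spv _; rewrite lerD2l ler_pM2l ?beta0 ?invr_gt0//.
    by rewrite lerXn2r ?nnegrE ?pnorm_ge0//; exact: le_trans u1.
  have uu : inner mu u u = inner mu v v + s^-1 * inner mu h v + sigma ^+ 2 * inner mu h h.
    rewrite -vhE !innerE (innerC v h) /sigma; field; exact: lt0r_neq0.
  have hh := mulr_ge0 (sqr_ge0 sigma) (inner_ge0 h).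
  have xv : x * (inner mu v v - B) <= inner mu h v.
    by rewrite -ler_pdivlMl// lerBlDr.
  have a0 : 0 < 1 + x / s by rewrite addr_gt0// divr_gt0.
  have step : (inner mu v v - B) * (1 + x / s) <= inner mu u u - B.
    have si : 0 <= s^-1 by rewrite invr_ge0 ltW.
    have := ler_wpM2l si xv; rewrite uu; lra.
  rewrite exprSr mulrA ler_pdivlMr//; exact: le_trans uB.
- move=> p; apply: etrans (vpsi p) _.
  by rewrite doubleS !addnS -!addSn; exact: uE.
Qed.

(** The squared norm of the [k]-th resolvent power dominates the integral of the
    spline, because [(1 - y)_+ <= (1 + y / 2)^-2]. *)
Lemma spectral_spline_le f (x s : R) (k : nat) : 0 < x -> 0 < s -> (f : X -> R) \in Lfun mu 1 ->
  (\int[spectral_measure E f]_(l in `[0%R, +oo[) (pospart (1 - l / s) ^+ k)%:E <=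
   (beta x^-1 * pnorm mu 1 f ^+ 2 +
    (inner mu f f - beta x^-1 * pnorm mu 1 f ^+ 2) * (1 + x / s)^-1 ^+ k)%:E)%E.
Proof.
move=> x0 s0 fL; set B := beta x^-1 * _; have [u [_ _ uB uE]] := resolvent_powers k x0 s0 fL.
have sigma0 : 0 < (2 * s)^-1 by rewrite invr_gt0 mulr_gt0.
apply: (@le_trans _ _ (inner mu u u)%:E); last by rewrite lee_fin; move: uB; rewrite -/B; lra.
have U0 : (\int[spectral_measure E u]_(l in `[0%R, +oo[) (resolvent_symbol (2 * s)^-1 l ^+ 0)%:E = (inner mu u u)%:E)%E.
  transitivity (\int[spectral_measure E u]_(l in `[0%R, +oo[) cst 1%E l)%E.
    by apply: eq_integral => l _; rewrite expr0.
  by rewrite integral_cst// mul1e; exact: spectral_measure_ge0.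
rewrite -U0 uE; clear U0 uE uB.
apply: ge0_le_integral => //.
- by move=> l _; rewrite lee_fin exprn_ge0// pospart_ge0.
- apply/measurable_EFinP/measurable_funTS; apply: measurable_funX.
  apply: (measurableT_comp (@measurable_pospart R)); apply: measurable_funB => //.
  exact: measurable_funM.
- by apply/measurable_EFinP/measurable_funTS; exact: measurable_resolvent_symbolX.
- move=> l; rewrite /= in_itv/= andbT => l0; rewrite lee_fin add0n -mul2n exprM.
  have p0 := resolvent_symbol_gt0 sigma0 l.
  rewrite lerXn2r ?nnegrE ?pospart_ge0 ?sqr_ge0//.
  (* (1 - y) (1 + y / 2)^2 <= 1 *)
  rewrite ge_max sqr_ge0/= /resolvent_symbol (ger0_norm l0).
  have -> : (2 * s)^-1 * l = l / s / 2 by field; exact: lt0r_neq0.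
  have y0 : 0 <= l / s by rewrite divr_ge0// ltW.
  set y := l / s in y0 *.
  have z0 : 0 < 1 + y / 2 by lra.
  rewrite exprVn -[leRHS]mul1r ler_pdivlMr ?exprn_gt0//.
  have y2 : 0 <= y ^+ 2 by rewrite sqr_ge0.
  have y3 : 0 <= y ^+ 3 by rewrite exprn_ge0.
  by move: y2 y3; rewrite !exprS expr0; lra.
Qed.

End resolvent_iteration.

Theorem theorem1p1 (R : realType) (d : measure_display) (X : measurableType d)
    (mu : {sigma_finite_measure set X -> \bar R})
    (T : R -> L2 mu -> L2 mu) (g beta : R -> R) :
  contraction_semigroup T ->
  bernstein g ->
  (forall r : R, 0 < r -> 0 < beta r) ->
  super_poincare (neg_generator T) 0%E +oo%E beta ->
  super_poincare (op_fun (ext_zero g) (neg_generator T))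
    (lim_infty g)^-1%E (lim_zero g)^-1%E
    (fun r => beta (inv_pos g r^-1)^-1).
Proof.
move=> TS bg beta0 sp f h [E TE [fdom hE]] fL r rr.
have [r0 x0 gx] := bernstein_inv bg rr.
set x := inv_pos g r^-1 in x0 gx *.
have G0 := ext_zero_ge0 bg; have mG := measurable_ext_zero bg.
have hf : inner mu h f = fine (\int[spectral_measure E f]_(l in `[0%R, +oo[) (ext_zero g l)%:E)%E.
  by rewrite hE// spectral_form_diag.
have Gfin : (\int[spectral_measure E f]_(l in `[0%R, +oo[) (ext_zero g l)%:E < +oo)%E.
  have mG2 : measurable_fun (`[0, +oo[%classic : set R) (fun l => (`|ext_zero g l| ^+ 2)%:E).
    apply/measurable_EFinP/measurable_funTS; apply: measurable_funX.
    exact: measurableT_comp.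
  apply: (@le_lt_trans _ _ (\int[spectral_measure E f]_(l in `[0%R, +oo[) (1%:E + (`|ext_zero g l| ^+ 2)%:E))%E).
    apply: ge0_le_integral => //.
    - by move=> l _; rewrite lee_fin.
    - by apply/measurable_EFinP/measurable_funTS.
    - by apply: emeasurable_funD.
    - move=> l _; rewrite -EFinD lee_fin real_normK ?num_real//.
      have := sqr_ge0 (ext_zero g l - 1); have := sqr_ge0 (ext_zero g l).
      by rewrite sqrrB; lra.
  rewrite ge0_integralD//.
  apply: lte_add_pinfty; last exact: fdom.
  by rewrite integral_cst// [X in (_ * X)%E]spectral_measure_ge0 ltry.
have Gge0 : (0 <= \int[spectral_measure E f]_(l in `[0%R, +oo[) (ext_zero g l)%:E)%E.
  by apply: integral_ge0 => l _; rewrite lee_fin.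
rewrite sqr_pnorm2; set B := beta x^-1 * _.
have B0 : 0 <= B by rewrite mulr_ge0 ?sqr_ge0// ltW// beta0// invr_gt0.
have hf0 : 0 <= inner mu h f by rewrite hf fine_ge0.
case: (leP (inner mu f f) B) => [fB|/ltW Bf].
  by apply: le_trans fB _; rewrite lerDr mulr_ge0// ltW.
have c0 : 0 <= inner mu f f - B by rewrite subr_ge0.
have mass : spectral_measure E f `[0, +oo[%classic = (B + (inner mu f f - B))%:E.
  by rewrite [LHS]spectral_measure_ge0 addrC subrK.
have spline (k : nat) (s : R) (s0 : 0 < s) := spectral_spline_le TS TE beta0 sp k x0 s0 fL.
have := bernstein_integral_ge x0 B0 c0 mass spline bg.
rewrite -[X in (_ <= X)%E -> _]fineK ?ge0_fin_numE// -hf lee_fin gx ler_pdivrMr// mulrC.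
by rewrite lerBlDr.
Qed.
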